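(* Let $D$ be an integral domain with fraction field $K$, let $I$ be a nonzero finitely generated ideal of $D$, and let $(\mathcal{X},\mathcal{O})$ be the blow-up scheme of $D$ (that is, of $\operatorname{Spec}D$) along $I$, identified with the projective model $\mathcal{W}(D;I)$. Let $D^{*}=\bigcap_{R\in\mathcal{X}}R(t)$. Then there exists a bijective correspondence between the relevant ideals of $D^{*}$ and the quasi-coherent sheaves of ideals on $(\mathcal{X},\mathcal{O})$.
   Context: Rings are commutative with identity; local rings need not be Noetherian; $t$ is an indeterminate. For an integral domain $A$, $\mathcal{S}(A)=\{A_P : P\text{ a prime ideal of }A\}$ (subrings of the fraction field of $A$), identified with $\operatorname{Spec}A$. For a subset $H\subseteq K$ containing a nonzero element, $\mathcal{W}(D;H)=\bigcup_{0\ne x\in H}\mathcal{S}(D[Hx^{-1}])$, where $D[Hx^{-1}]$ is the subring of $K$ generated by $D$ and all $yx^{-1}$, $y\in H$. If $I=(a_1,\dots,a_n)$ with all $a_i\neq 0$, then $\mathcal{W}(D;I)=\bigcup_i\mathcal{S}(D[Ia_i^{-1}])$ and the blow-up of $\operatorname{Spec}D$ along $I$ is the gluing of the affine schemes $\operatorname{Spec}D[Ia_i^{-1}]$; as a scheme it is identified with $\mathcal{X}=\mathcal{W}(D;I)$, with the Zariski topology (basis: the sets $\{R\in\mathcal{X}:R\supseteq H\}$, $H\subseteq K$ finite) and structure sheaf $\mathcal{O}(U)=\bigcap_{R\in U}R$ for nonempty open $U$ (zero ring for $U=\emptyset$). The points of $\mathcal{X}$ are thus the local rings of the blow-up, viewed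 as subrings of $K$. A polynomial in $R[t]$ is primitive if its coefficients generate the unit ideal of $R$. The Nagata extension $R(t)$ is the localization of $R[t]$ at the multiplicative set of primitive polynomials; for $R\in\mathcal{X}$ it is viewed inside $K(t)$. An ideal $J$ of $R(t)$ is called relevant if $J=(J\cap R)R(t)$. An ideal $J$ of $D^{*}$ is called relevant if its extension $JR(t)$ is a relevant ideal of $R(t)$ for every $R\in\mathcal{X}$. *)

(* Defs.v *)
From HB Require Import structures.
From mathcomp Require Import all_boot all_algebra fraction.
From mathcomp Require Import boolp classical_sets functions cardinality topology.

Set Implicit Arguments.
Unset Strict Implicit.
Unset Printing Implicit Defensive.

Import GRing.Theory.
Local Open Scope classical_set_scope.
Local Open Scope ring_scope.

(* Subrings of a field, and their ideals, are sets of elements of the field. *)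

Section Subrings.
Variable L : comNzRingType.
Implicit Types A J G H : set L.

Definition subring A : Prop := subring_closed (mem A).

Definition generated_subring G : set L := smallest subring G.

(* The unit ideal is allowed, unlike in [idealr_closed]. *)
Definition is_ideal A J : Prop :=
  [/\ J `<=` A, J 0,
      forall x y, J x -> J y -> J (x + y)
    & forall a x, A a -> J x -> J (a * x)].

Definition generated_ideal A G : set L := smallest (is_ideal A) G.

Definition finitely_generated_ideal A J : Prop :=
  is_ideal A J /\ exists2 G, finite_set G & J = generated_ideal A G.

Definition prime_ideal A P : Prop :=
  [/\ is_ideal A P, ~ P 1 &
      forall a b, A a -> A b -> P (a * b) -> P a \/ P b].

End Subrings.

Section LocalRings.
Variable K : fieldType.
Implicit Types A P D H : set K.

Definition localization A P : set K :=
  [set z | exists a s, [/\ A a, A s, ~ P s & z = a / s]].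

Definition local_rings A : set (set K) :=
  [set localization A P | P in prime_ideal A].

(* D[H x^-1] *)
Definition chart_ring D H (x : K) : set K :=
  generated_subring (D `|` [set y / x | y in H]).

Definition projective_model D H : set (set K) :=
  \bigcup_(x in [set x | H x /\ x != 0]) local_rings (chart_ring D H x).

(* W(D; H) as a type. *)
Definition model D H := {R : set K | projective_model D H R}.

End LocalRings.

Section Zariski.
Variables (K : fieldType) (D H : set K).
Local Notation X := (model D H).

HB.instance Definition _ := gen_eqMixin X.
HB.instance Definition _ := gen_choiceMixin X.

Definition zariski_basic (F : set K) : set X := [set R | F `<=` sval R].

Fact zariski_basic_cover : \bigcup_(F in @finite_set K) zariski_basic F = setT.
Proof. by apply/seteqP; split=> // R _; exists set0 => //; exact: sub0set. Qed.

Fact zariski_basic_join (F G : set K) (R : X) :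
  finite_set F -> finite_set G -> zariski_basic F R -> zariski_basic G R ->
  exists E, [/\ finite_set E, zariski_basic E R
              & zariski_basic E `<=` zariski_basic F `&` zariski_basic G].
Proof.
move=> finF finG FR GR; exists (F `|` G); split.
- by rewrite finite_setU.
- by rewrite /zariski_basic/= subUset.
- by move=> S; rewrite /zariski_basic/= subUset.
Qed.

HB.instance Definition _ :=
  isBaseTopological.Build X zariski_basic_cover zariski_basic_join.

End Zariski.

Section IdealSheaves.
Variables (K : fieldType) (D H : set K).
Local Notation X := (model D H).
Implicit Types U V : set X.

(* All rings of sections are subsets of K.  The zero ring O(set0) is encoded
   as {0}, and restriction to set0 is the zero map; all other restriction maps
   are inclusions. *)
Definition structure_sheaf U : set K :=
  if U == set0 then [set 0] else \bigcap_(R in U) sval R.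

Definition restr V (s : K) : K := if V == set0 then 0 else s.

(* A (pre)sheaf is a function on the open sets.  It is extended by set0 to the
   other sets, so that equality of such functions is equality of sheaves. *)
Definition sheaf_of_ideals (F : set X -> set K) : Prop :=
  [/\ forall U, ~ open U -> F U = set0,
      forall U, open U -> is_ideal (structure_sheaf U) (F U),
      forall U V, open U -> open V -> V `<=` U ->
        forall s, F U s -> F V (restr V s)
    & forall (T : Type) (U : T -> set X) (s : T -> K),
        (forall i, open (U i)) -> (forall i, F (U i) (s i)) ->
        (forall i j, restr (U i `&` U j) (s i) = restr (U i `&` U j) (s j)) ->
        exists! r, F (\bigcup_i U i) r /\ forall i, restr (U i) r = s i].

(* The open set U is Spec A: as the points of X are subrings of K, this means
   that A embeds in K in such a way that the points of U are the localizations
   of A at its primes. *)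
Definition affine_open U (A : comNzRingType) (iota : {rmorphism A -> K}) :
    Prop :=
  [/\ open U, injective iota
    & [set sval R | R in U] = local_rings (range iota)].

(* D(f), the set of points of U where f is invertible. *)
Definition standard_open U (f : K) : set X :=
  [set R | U R /\ exists2 g, sval R g & f * g = 1].

(* The restriction of F to U = Spec A is isomorphic to the sheaf M~, which is
   given by M~(D(f)) = M_f on the base of standard open sets.  An isomorphism
   is determined by its component theta on U = D(1); the condition is that for
   each f the map theta, followed by restriction to D(f), makes F(D(f)) the
   localization M_f. *)
Definition iso_tilde (F : set X -> set K) U (A : comNzRingType)
    (iota : {rmorphism A -> K}) (M : lmodType A) : Prop :=
  exists theta : {linear M -> K | iota \; *%R},
    (forall m, F U (theta m)) /\
    forall f : A, let Uf := standard_open U (iota f) in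
      (forall s, F Uf s ->
         exists n m, restr Uf (iota f) ^+ n * s = restr Uf (theta m)) /\
      (forall m, restr Uf (theta m) = 0 -> exists n, f ^+ n *: m = 0).

Definition quasi_coherent (F : set X -> set K) : Prop :=
  forall R : X, exists U, U R /\
    exists (A : comNzRingType) (iota : {rmorphism A -> K}),
      affine_open U iota /\ exists M : lmodType A, iso_tilde F U iota M.

Definition quasi_coherent_ideal_sheaf (F : set X -> set K) : Prop :=
  sheaf_of_ideals F /\ quasi_coherent F.

End IdealSheaves.

Section Nagata.
Variable K : fieldType.
Implicit Types R : set K.

Local Notation Kt := {fraction {poly K}}.

Definition constant (x : K) : Kt := tofrac x%:P.

Definition primitive_poly R (q : {poly K}) : Prop :=
  q \is a polyOver (mem R) /\ generated_ideal R [set` (q : seq K)] = R.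

(* R(t), inside K(t) *)
Definition nagata R : set Kt :=
  [set z | exists p q : {poly K},
     [/\ p \is a polyOver (mem R), primitive_poly R q
       & z = tofrac p / tofrac q]].

Definition relevant_nagata_ideal R (J : set Kt) : Prop :=
  is_ideal (nagata R) J /\
  J = generated_ideal (nagata R) (J `&` [set constant x | x in R]).

Section Star.
Variables D H : set K.

Definition nagata_star : set Kt :=
  \bigcap_(R in projective_model D H) nagata R.

Definition relevant_ideal (J : set Kt) : Prop :=
  is_ideal nagata_star J /\
  forall R, projective_model D H R ->
    relevant_nagata_ideal R (generated_ideal (nagata R) J).

End Star.
End Nagata.

(* Main.v *)
(* To a relevant ideal J of D^* corresponds the sheaf whose stalk at
   R is J R(t) :&: R, and to a quasi-coherent sheaf of ideals with stalks N_R the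
   intersection over all R of the ideals N_R R(t).

   The elements of R(t) are the quotients g / q, where g and q are polynomials
   with coefficients in the sections of O(N) = I^N O for some N, and where the
   content of q is I^N R.  If p is the polynomial whose coefficients generate I,
   then, for m large, q' = q + t^m p^N has content I^N R' for all points R', so
   that g / q' and q / q' belong to D^*: hence R(t) is a localization of D^*.  The
   same spreading of contents shows that an ideal of D^* containing a unit of
   R(t) for each R is the unit ideal; so J is the intersection of the J R(t).

   The quasi-coherence of the sheaf of J comes down to the following: if s is in
   the stalks of J wherever f is invertible, then f^n s is in all the stalks for
   some n.  Since J R(t) is extended from R, this follows from the avoidance of
   the powers of f by a prime of R containing the conductor of s.  Conversely, a
   germ x of a quasi-coherent sheaf of ideals, defined where a section c of O(N)
   does not vanish, extends after multiplication by a power of c; so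
   (c / p^N)^m x is in the ideal of D^* attached to the sheaf, and c / p^N is a
   unit of R(t). *)

Require Import Defs.
From HB Require Import structures.
From mathcomp Require Import all_boot all_algebra fraction generic_quotient.
From mathcomp Require Import ring.
From mathcomp Require Import boolp classical_sets functions cardinality topology.

Set Implicit Arguments.
Unset Strict Implicit.
Unset Printing Implicit Defensive.

Import GRing.Theory.
Local Open Scope classical_set_scope.
Local Open Scope ring_scope.

Local Notation constant := Defs.constant.

(** * Prime ideals, localizations and quasi-compactness *)

Section Subrings.
Variables (L : comNzRingType) (A : set L).

Lemma subringP : subring A <->
  [/\ A 1, forall x y, A x -> A y -> A (x - y)
         & forall x y, A x -> A y -> A (x * y)].
Proof.
split=> [[A1 AB AM]|[A1 AB AM]]; split.
- exact: set_mem A1.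
- by move=> x y /mem_set Ax /mem_set Ay; exact: set_mem (AB _ _ Ax Ay).
- by move=> x y /mem_set Ax /mem_set Ay; exact: set_mem (AM _ _ Ax Ay).
- exact: mem_set A1.
- by move=> x y /set_mem Ax /set_mem Ay; exact: mem_set (AB _ _ Ax Ay).
- by move=> x y /set_mem Ax /set_mem Ay; exact: mem_set (AM _ _ Ax Ay).
Qed.

Hypothesis ringA : subring A.

Lemma subring1 : A 1. Proof. by case/subringP: ringA. Qed.

Lemma subringB x y : A x -> A y -> A (x - y).
Proof. by case/subringP: ringA => _ + _; apply. Qed.

Lemma subringM x y : A x -> A y -> A (x * y).
Proof. by case/subringP: ringA => _ _; apply. Qed.

Lemma subring0 : A 0.
Proof. by rewrite -(subrr 1); apply: subringB; exact: subring1. Qed.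

Lemma subringN x : A x -> A (- x).
Proof. by rewrite -sub0r; apply: subringB; exact: subring0. Qed.

Lemma subringD x y : A x -> A y -> A (x + y).
Proof. by move=> Ax Ay; rewrite -[y]opprK; apply/subringB/subringN. Qed.

Lemma subringX x n : A x -> A (x ^+ n).
Proof.
move=> Ax; elim: n => [|n IHn]; first by rewrite expr0; exact: subring1.
by rewrite exprS; exact: subringM.
Qed.

Lemma subring_is_ideal : is_ideal A A.
Proof.
by split; [|exact: subring0|exact: subringD|exact: subringM].
Qed.

Section Ideal.
Variable J : set L.
Hypothesis idJ : is_ideal A J.

Lemma ideal_subset x : J x -> A x. Proof. by case: idJ => + _ _ _; apply. Qed.
Lemma ideal_zero : J 0. Proof. by case: idJ. Qed.
Lemma ideal_add x y : J x -> J y -> J (x + y).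
Proof. by case: idJ => _ _ + _; apply. Qed.
Lemma ideal_mull a x : A a -> J x -> J (a * x).
Proof. by case: idJ => _ _ _; apply. Qed.
Lemma ideal_mulr a x : A a -> J x -> J (x * a).
Proof. by rewrite mulrC; exact: ideal_mull. Qed.
Lemma ideal_sum (T : Type) (s : seq T) (P : pred T) (F : T -> L) :
  (forall i, P i -> J (F i)) -> J (\sum_(i <- s | P i) F i).
Proof. by move=> JF; apply: big_ind => //; [exact: ideal_zero|exact: ideal_add]. Qed.
Lemma ideal_has1 : J 1 -> J = A.
Proof.
move=> J1; apply/seteqP; split=> x; first exact: ideal_subset.
by move=> Ax; rewrite -[x]mulr1; exact: ideal_mull.
Qed.
End Ideal.

Lemma generated_ideal_ideal G : G `<=` A -> is_ideal A (generated_ideal A G).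
Proof.
move=> GA; split.
- by move=> x; apply; split=> //; exact: subring_is_ideal.
- by move=> J [idJ _]; exact: ideal_zero idJ.
- move=> x y Jx Jy J JG; apply: (ideal_add JG.1); [exact: Jx|exact: Jy].
- by move=> a x Aa Jx J JG; apply: (ideal_mull JG.1) => //; exact: Jx.
Qed.

Lemma sub_generated_ideal G : G `<=` generated_ideal A G.
Proof. exact: sub_smallest. Qed.

Lemma generated_ideal_sub G J :
  is_ideal A J -> G `<=` J -> generated_ideal A G `<=` J.
Proof. by move=> idJ GJ x; apply. Qed.

(** Krull's argument: an ideal maximal among those containing [C] and disjoint from the
    multiplicative set [S] is prime. *)
Lemma exists_prime_avoiding (C S : set L) :
  is_ideal A C -> S `<=` A -> S 1 ->
  (forall x y, S x -> S y -> S (x * y)) -> (forall x, C x -> ~ S x) ->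
  exists2 P, prime_ideal A P & C `<=` P /\ (forall x, P x -> ~ S x).
Proof.
move=> idC SA S1 SM CS.
pose good B := [/\ is_ideal A B, C `<=` B & forall x, B x -> ~ S x].
have [F FP Ftot|P [goodP maxP]] :=
    @Zorn_bigcup L [set B | B !=set0 -> good B].
  move=> [x0 [B0 FB0 B0x0]].
  have Fgood B y : F B -> B y -> good B.
    by move=> FB By; apply: FP => //; exists y.
  have [idB0 CB0 _] := Fgood _ _ FB0 B0x0.
  split.
  - split.
    + by move=> x [B FB Bx]; have [idB _ _] := Fgood _ _ FB Bx;
      exact: ideal_subset idB _ Bx.
    + by exists B0 => //; exact: ideal_zero idB0.
    + move=> x y [B FB Bx] [B' FB' By].
      have [idB _ _] := Fgood _ _ FB Bx.
      have [idB' _ _] := Fgood _ _ FB' By.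
      have [BB'|B'B] := Ftot _ _ FB FB'.
        by exists B' => //; apply: (ideal_add idB') => //; exact: BB'.
      by exists B => //; apply: (ideal_add idB) => //; exact: B'B.
    + move=> a x Aa [B FB Bx]; exists B => //.
      by have [idB _ _] := Fgood _ _ FB Bx; exact: (ideal_mull idB).
  - by move=> x Cx; exists B0 => //; exact: CB0.
  - by move=> x [B FB Bx]; have [_ _] := Fgood _ _ FB Bx; apply.
have Pgood : good P.
  have [P0|/set0P/goodP//] := eqVneq P set0.
  exfalso; apply: (maxP C) => [|_]; last by split.
  by rewrite P0; split; [exact: sub0set|move/(_ _ (ideal_zero idC))].
have [idP CP PS] := Pgood.
exists P => //; split=> //.
  by move/PS.
move=> a b Aa Ab Pab; apply: contrapT => /not_orP[nPa nPb].
(* By maximality [P + A c] meets [S]. The product of the two elements found for [a] and [b] lies in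
   [S], and also in [P] because [a * b] does. *)
have adjoin c : A c -> ~ P c -> exists x u, [/\ P x, A u & S (x + u * c)].
  move=> Ac nPc; apply: contrapT => nS.
  pose Q := [set z | exists x u, [/\ P x, A u & z = x + u * c]].
  apply: (maxP Q).
    split; first by move=> x Px; exists x, 0; split; [|exact: subring0|ring].
    move=> QP; apply/nPc/QP; exists 0, 1; split; [|exact: subring1|ring].
    exact: ideal_zero idP.
  move=> _; split.
  - split.
    + move=> _ [x [u [Px Au ->]]]; apply: subringD.
        exact: ideal_subset idP _ Px.
      exact: subringM.
    + by exists 0, 0; split; [exact: ideal_zero idP|exact: subring0|ring].
    + move=> _ _ [x [u [Px Au ->]]] [y [v [Py Av ->]]].
      by exists (x + y), (u + v); split; [exact: (ideal_add idP)|exact: subringD|ring].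
    + move=> d _ Ad [x [u [Px Au ->]]].
      by exists (d * x), (d * u); split; [exact: (ideal_mull idP)|exact: subringM|ring].
  - by move=> x Cx; exists x, 0; split; [exact: CP|exact: subring0|ring].
  - by move=> _ [x [u [Px Au ->]]] Sz; apply: nS; exists x, u.
have [x [u [Px Au Sx]]] := adjoin a Aa nPa.
have [y [v [Py Av Sy]]] := adjoin b Ab nPb.
apply: PS _ (SM _ _ Sx Sy).
have -> : (x + u * a) * (y + v * b) =
          (y + v * b) * x + (u * a) * y + (u * v) * (a * b) by ring.
have PA := ideal_subset idP.
apply: (ideal_add idP); first apply: (ideal_add idP).
- by apply: (ideal_mull idP) => //; apply: subringD; [exact: PA|exact: subringM].
- by apply: (ideal_mull idP) => //; exact: subringM.
- by apply: (ideal_mull idP) => //; exact: subringM.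
Qed.

Lemma exists_prime (C : set L) : is_ideal A C -> ~ C 1 ->
  exists2 P, prime_ideal A P & C `<=` P.
Proof.
move=> idC C1.
have [||||P primeP [CP _]] := @exists_prime_avoiding C [set 1] idC.
- by move=> _ ->; exact: subring1.
- by [].
- by move=> x y -> ->; rewrite mulr1.
- by move=> x Cx x1; apply: C1; rewrite -x1.
- by exists P.
Qed.

End Subrings.

Section LocalSubrings.
Variable K : fieldType.
Implicit Types A R P : set K.

(** The inverse of 0 is 0 by convention, so that both memberships hold at 0 in every subring;
    [x != 0] excludes it. *)
Definition unit_in R x := [/\ R x, x != 0 & R x^-1].

Definition local_subring R :=
  subring R /\ forall x y, R x -> R y -> unit_in R (x + y) ->
    unit_in R x \/ unit_in R y.

Lemma unit_in1 R : subring R -> unit_in R 1.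
Proof. by move=> rR; split; rewrite ?oner_neq0 ?invr1 //; exact: subring1. Qed.

Lemma unit_inM R x y : subring R ->
  unit_in R x -> unit_in R y -> unit_in R (x * y).
Proof.
move=> rR [Rx x0 Rx'] [Ry y0 Ry']; split; first exact: subringM.
  by rewrite mulf_neq0.
by rewrite invfM; exact: subringM.
Qed.

Lemma unit_inX R x n : subring R -> unit_in R x -> unit_in R (x ^+ n).
Proof.
move=> rR ux; elim: n => [|n IHn]; first by rewrite expr0; exact: unit_in1.
by rewrite exprS; exact: unit_inM.
Qed.

Lemma unit_inV R x : unit_in R x -> unit_in R x^-1.
Proof. by move=> [Rx x0 Rx']; split; rewrite ?invr_eq0 ?invrK. Qed.

Lemma unit_in_factor R x y : subring R -> R x -> R y ->
  unit_in R (x * y) -> unit_in R x.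
Proof.
move=> rR Rx Ry [_]; rewrite mulf_eq0 negb_or => /andP[x0 y0] Rxy; split=> //.
have -> : x^-1 = y * (x * y)^-1 by field; rewrite y0.
exact: subringM.
Qed.

Lemma unit_in_sum R (T : eqType) (s : seq T) (Q : pred T) (F : T -> K) :
  local_subring R -> (forall i, Q i -> R (F i)) ->
  unit_in R (\sum_(i <- s | Q i) F i) ->
  exists i, [/\ i \in s, Q i & unit_in R (F i)].
Proof.
move=> [rR locR] RF; elim: s => [|i s IHs].
  by rewrite big_nil => -[_]; rewrite eqxx.
have Rs : R (\sum_(j <- s | Q j) F j).
  by apply: (ideal_sum (subring_is_ideal rR)).
rewrite big_cons; case: ifP => [Qi|_] us; last first.
  by have [j [sj Qj uj]] := IHs us; exists j; rewrite inE sj orbT.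
have [ui|{}us] := locR _ _ (RF _ Qi) Rs us; first by exists i; rewrite inE eqxx.
by have [j [sj Qj uj]] := IHs us; exists j; rewrite inE sj orbT.
Qed.

Section Localization.
Variables A P : set K.
Hypotheses (rA : subring A) (primeP : prime_ideal A P).

Let idP : is_ideal A P. Proof. by case: primeP. Qed.
Let P1 : ~ P 1. Proof. by case: primeP. Qed.
Let primeM a b : A a -> A b -> P (a * b) -> P a \/ P b.
Proof. by case: primeP => _ _; apply. Qed.
Let nP0 s : ~ P s -> s != 0.
Proof. by apply: contra_notN => /eqP ->; exact: ideal_zero idP. Qed.
Let nPM s t : A s -> A t -> ~ P s -> ~ P t -> ~ P (s * t).
Proof. by move=> As At ns nt /primeM[]. Qed.

Lemma localization_sub : A `<=` localization A P.
Proof.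
move=> x Ax; exists x, 1; split=> //; [exact: subring1|by rewrite divr1].
Qed.

Lemma localization_subring : subring (localization A P).
Proof.
apply/subringP; split; first by apply: localization_sub; exact: subring1.
- move=> x y [a [s [Aa As /[dup] Ps /nP0 s0 ->]]].
  move=> [b [t [Ab At /[dup] Pt /nP0 t0 ->]]].
  exists (a * t - b * s), (s * t); split; last by field; rewrite s0 t0.
  + by apply: subringB => //; exact: subringM.
  + exact: subringM.
  + exact: nPM.
- move=> x y [a [s [Aa As /[dup] Ps /nP0 s0 ->]]].
  move=> [b [t [Ab At /[dup] Pt /nP0 t0 ->]]].
  exists (a * b), (s * t); split; last by field; rewrite s0 t0.
  + exact: subringM.
  + exact: subringM.
  + exact: nPM.
Qed.

Lemma localization_unit a : A a -> ~ P a -> unit_in (localization A P) a.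
Proof.
move=> Aa Pa; split; [exact: localization_sub|exact: nP0|].
by exists 1, a; split; rewrite ?div1r //; exact: subring1.
Qed.

Lemma localization_unitN a : A a -> unit_in (localization A P) a -> ~ P a.
Proof.
move=> Aa [_ a0 [b [s [Ab As Ps e]]]] Pa; apply: Ps.
suff -> : s = b * a by exact: (ideal_mull idP).
have s0 : s != 0.
  by apply: contra_neq a0 => s0; rewrite -[a]invrK e s0 invr0 mulr0 invr0.
have b0 : b != 0 by apply: contra_neq a0 => b0; rewrite -[a]invrK e b0 mul0r invr0.
by rewrite -[a]invrK e; field; rewrite ?s0.
Qed.

End Localization.
End LocalSubrings.

Section LocalizationLocal.
Variable K : fieldType.
Implicit Types A R P : set K.

Lemma localization_local A P : subring A -> prime_ideal A P ->
  local_subring (localization A P).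
Proof.
move=> rA primeP; split; first exact: localization_subring.
have rR := localization_subring rA primeP.
move=> x y [a [s [Aa As Ps ->]]] [b [t [Ab At Pt ->]]] u.
have us := localization_unit rA primeP As Ps.
have ut := localization_unit rA primeP At Pt.
have [[_ s0 _] [_ t0 _]] := (us, ut).
have : unit_in (localization A P) (a * t + b * s).
  have -> : a * t + b * s = (a / s + b / t) * s * t by field; rewrite ?s0 ?t0.
  by apply: unit_inM => //; exact: unit_inM.
have AN : A (a * t + b * s) by apply: subringD => //; exact: subringM.
move/(localization_unitN primeP AN) => nP.
have [idP _ _] := primeP.
have [Pa|Pa] := pselect (P a); [right|left]; apply: unit_inM => //.
all: try (exact: unit_inV).
all: apply: localization_unit => //.
move=> Pb; apply: nP; apply: (ideal_add idP). all: exact: (ideal_mulr idP).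
Qed.

(** Where the common denominator [g] is a unit, [F] lies in the local ring: a basic neighbourhood of
    a point of Spec A contains a standard one, D(g). *)
Lemma localization_denom A P (F : seq K) : subring A -> prime_ideal A P ->
  [set` F] `<=` localization A P ->
  exists g, [/\ A g, ~ P g & forall x, x \in F -> A (g * x)].
Proof.
move=> rA primeP; have [_ P1 primeM] := primeP.
elim: F => [|x F IHF] FA.
  by exists 1; split=> //; exact: subring1.
have [|g [Ag Pg gF]] := IHF.
  by move=> y yF; apply: FA; rewrite /= inE (yF : y \in F) orbT.
have /FA[a [s [Aa As Ps xE]]] : [set` x :: F] x by rewrite /= inE eqxx.
have [_ s0 _] := localization_unit rA primeP As Ps.
exists (s * g); split.
- exact: subringM.
- by move/(primeM _ _ As Ag) => [].
- move=> y; rewrite inE => /predU1P[->|yF].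
    have -> : s * g * x = g * a by rewrite xE; field.
    exact: subringM.
  by rewrite -mulrA; apply: subringM => //; exact: gF.
Qed.

Lemma unit_in_cancel R g x : subring R -> unit_in R g -> R (g * x) -> R x.
Proof.
move=> rR [_ g0 Rg'] Rgx; have -> : x = g^-1 * (g * x) by field.
exact: subringM.
Qed.

Lemma local_rings_local A R : subring A -> local_rings A R -> local_subring R.
Proof. by move=> rA [P primeP <-]; exact: localization_local. Qed.

Lemma local_rings_sub A R : subring A -> local_rings A R -> A `<=` R.
Proof. by move=> rA [P primeP <-]; exact: localization_sub. Qed.

(* Quasi-compactness of Spec A as an induction principle. *)
Lemma local_rings_quasi_compact A (T : set (set K) -> Prop) : subring A ->
  T set0 -> (forall V W, V `<=` W -> T W -> T V) ->
  (forall V W, T V -> T W -> T (V `|` W)) ->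
  (forall R, local_rings A R -> exists2 F : seq K, [set` F] `<=` R &
     T (local_rings A `&` [set R' | [set` F] `<=` R'])) ->
  T (local_rings A).
Proof.
move=> rA T0 Tsub TU Tloc.
pose Ug g := local_rings A `&` [set R | unit_in R g].
(* The [g] such that [T] holds on D(g) form an ideal. A prime [P] containing it would contradict the
   hypothesis at the point [localization A P], which has a neighbourhood D(g) satisfying [T] with
   [g] outside [P]. *)
pose C := [set g | A g /\ T (Ug g)].
have idC : is_ideal A C.
  split.
  - by move=> g [].
  - split; first exact: subring0.
    by apply: Tsub T0 => R [_ [_]]; rewrite eqxx.
  - move=> g h [Ag Tg] [Ah Th]; split; first exact: subringD.
    apply: Tsub (TU _ _ Tg Th) => R [AR ugh].
    have [rR locR] := local_rings_local rA AR.
    have AsubR := local_rings_sub rA AR.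
    by have [] := locR _ _ (AsubR _ Ag) (AsubR _ Ah) ugh; [left|right].
  - move=> a g Aa [Ag Tg]; split; first exact: subringM.
    apply: Tsub Tg => R [AR uag]; split=> //=.
    have [rR _] := local_rings_local rA AR.
    have AsubR := local_rings_sub rA AR.
    apply: (unit_in_factor rR (AsubR _ Ag) (AsubR _ Aa)); first by rewrite mulrC.
suff [_] : C 1.
  apply: Tsub => R AR; split=> //=.
  by have [rR _] := local_rings_local rA AR; exact: unit_in1.
apply: contrapT => /(exists_prime rA idC)[P primeP CP].
have [|F FR TF] := Tloc (localization A P); first by exists P.
have [g [Ag Pg gF]] := localization_denom rA primeP FR.
apply/Pg/CP; split=> //; apply: Tsub TF => R [AR ug]; split=> // x xF.
have [rR _] := local_rings_local rA AR.
exact: unit_in_cancel rR ug (local_rings_sub rA AR (gF _ xF)).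
Qed.

End LocalizationLocal.

(** * Primitive polynomials and Nagata rings *)

Section Primitive.
Variable K : fieldType.
Implicit Types R n : set K.
Implicit Types p q : {poly K}.

Definition coefs_in R q := forall i, R q`_i.

Definition primitive_at R q := coefs_in R q /\ exists i, unit_in R q`_i.

Lemma polyOver_coefs_in R q : R 0 -> q \is a polyOver (mem R) <-> coefs_in R q.
Proof.
move=> R0; split=> [/(all_nthP 0) qR i|qR].
  have [/qR/set_mem//|szq] := ltnP i (size q).
  by rewrite nth_default.
by apply/(all_nthP 0) => i _; exact/mem_set/qR.
Qed.

Lemma primitive_at_neq0 R q : primitive_at R q -> q != 0.
Proof.
by move=> [_ [i [_ + _]]]; apply: contra_neq => ->; rewrite coef0.
Qed.

(** The nonunits of a local ring form a proper ideal, so coefficients generate the unit ideal only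
    if one of them is a unit. *)
Lemma primitive_polyP R q : local_subring R ->
  primitive_poly R q <-> primitive_at R q.
Proof.
move=> [rR locR]; have R0 := subring0 rR.
split=> [[/(polyOver_coefs_in _ R0) qR q1]|[qR [i [Rqi qi0 Rqi']]]]; split=> //.
- apply: contrapT => nou.
  pose M := [set x | R x /\ ~ unit_in R x].
  have idM : is_ideal R M.
    split.
    + by move=> x [].
    + by split=> // -[_]; rewrite eqxx.
    + move=> x y [Rx nx] [Ry ny]; split; first exact: subringD.
      by move/(locR _ _ Rx Ry) => [].
    + move=> a x Ra [Rx nx]; split; first exact: subringM.
      by rewrite mulrC => /(unit_in_factor rR Rx Ra).
  have : M 1; last by move=> [_]; apply; exact: unit_in1.
  have : generated_ideal R [set` (q : seq K)] 1 by rewrite q1; exact: subring1.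
  apply: generated_ideal_sub => // x /(nthP 0)[j _ <-]; split; first exact: qR.
  by move=> u; apply: nou; exists j.
- exact/polyOver_coefs_in.
- have qsub : [set` (q : seq K)] `<=` R by move=> x /(nthP 0)[j _ <-].
  have idq := generated_ideal_ideal rR qsub.
  apply: (ideal_has1 idq); rewrite -(mulVf qi0); apply: (ideal_mull idq) => //.
  apply: sub_generated_ideal => /=; apply: mem_nth; rewrite ltnNge.
  by apply: contra_neqN qi0 => ?; rewrite nth_default.
Qed.

Lemma coefs_in_ideal R n : subring R -> is_ideal R n ->
  [/\ forall p q, coefs_in n p -> coefs_in n q -> coefs_in n (p + q),
      forall p q, coefs_in R p -> coefs_in n q -> coefs_in n (p * q)
    & coefs_in n 0].
Proof.
move=> rR idn; split.
- by move=> p q np nq i; rewrite coefD; exact: (ideal_add idn).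
- move=> p q Rp nq i; rewrite coefM; apply: (ideal_sum idn) => j _.
  exact: (ideal_mull idn).
- by move=> i; rewrite coef0; exact: ideal_zero idn.
Qed.

Lemma coefs_in_C R (c : K) : R 0 -> R c -> coefs_in R c%:P.
Proof. by move=> R0 Rc i; rewrite coefC; case: ifP. Qed.

Lemma coefs_in_Xn R m : subring R -> coefs_in R 'X^m.
Proof.
move=> rR i; rewrite coefXn; case: eqP => _; [exact: subring1|exact: subring0].
Qed.

Lemma primitive_at1 R : subring R -> primitive_at R 1.
Proof.
move=> rR; split; first by apply: coefs_in_C; [exact: subring0|exact: subring1].
by exists 0%N; rewrite coefC; exact: unit_in1.
Qed.

(* Gauss: at the lowest indices [i], [j] of unit coefficients, all the other
   terms of the coefficient of index [i + j] of the product are nonunits. *)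
Lemma primitive_atM R p q : local_subring R ->
  primitive_at R p -> primitive_at R q -> primitive_at R (p * q).
Proof.
move=> locR [Rp up] [Rq uq]; have rR := locR.1.
have [_ RM _] := coefs_in_ideal rR (subring_is_ideal rR).
split; first exact: RM.
have least (s : {poly K}) : (exists i, unit_in R s`_i) ->
    exists i, unit_in R s`_i /\ forall j, (j < i)%N -> ~ unit_in R s`_j.
  move=> [i ui]; have ex : exists i, `[< unit_in R s`_i >].
    by exists i; exact/asboolP.
  exists (ex_minn ex); case: ex_minnP => m /asboolP um min; split=> // j jm.
  by move/asboolP/min; rewrite leqNgt jm.
have [i [ui mini]] := least _ up; have [j [uj minj]] := least _ uq.
exists (i + j)%N; apply: contrapT => nu.
have iord : (i < (i + j).+1)%N by rewrite ltnS leq_addr.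
(* A single sum, to which locality applies: index 0 carries the coefficient of [p * q], and index
   [k + 1] the negative of the [k]-th convolution term, replaced by 0 for [k = i]. *)
have E : p`_i * q`_j = \sum_(k < (i + j).+2)
    (if unlift ord0 k is Some k' then
       if k' == i :> nat then 0 else - (p`_k' * q`_(i + j - k'))
     else (p * q)`_(i + j)).
  rewrite big_ord_recl unlift_none coefM.
  under [X in _ = _ + X]eq_bigr do rewrite liftK.
  rewrite -big_split /= (bigD1 (Ordinal iord)) //= eqxx addr0 addKn.
  rewrite big1 ?addr0 // => k; rewrite -val_eqE /= => /negbTE ->.
  exact: subrr.
have : unit_in R (p`_i * q`_j) by exact: unit_inM.
rewrite E => /(unit_in_sum locR)[k _|k [_ _]].
  case: unliftP => [k' _|_]; last exact: RM.
  case: ifP => _; first exact: subring0.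
  by apply: subringN => //; exact: subringM.
case: unliftP => [k' _|_ //]; case: eqP => [_ [_]|]; first by rewrite eqxx.
move=> k'i; rewrite -mulNr => u.
have RNp := subringN rR (Rp k').
have [k'lt|k'ge] := ltnP k' i.
  apply: (mini k') => //.
  rewrite -[p`_k']opprK -mulN1r; apply: unit_inM => //; last first.
    exact: unit_in_factor RNp (Rq _) u.
  split; rewrite ?oppr_eq0 ?oner_neq0 ?invrN1 //;
    by apply: subringN => //; exact: subring1.
apply: (minj (i + j - k')%N).
  rewrite -(ltn_add2r k') subnK; last by rewrite -ltnS.
  rewrite [ltnRHS]addnC ltn_add2r ltn_neqAle k'ge andbT eq_sym.
  exact/eqP.
by apply: (unit_in_factor rR (Rq _) RNp); rewrite mulrC.
Qed.

End Primitive.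

(** * Nagata rings of local rings, extension and contraction of ideals *)

Section NagataLocal.
Variables (K : fieldType) (R n : set K).
Hypotheses (locR : local_subring R) (idn : is_ideal R n).

Local Notation "p %:F" := (tofrac p).
Let rR : subring R := locR.1.

Lemma nagataP z : nagata R z <->
  exists p q, [/\ coefs_in R p, primitive_at R q & z = p%:F / q%:F].
Proof.
have R0 := subring0 rR.
split=> -[p [q [Rp Rq ->]]]; exists p, q; split=> //.
- exact/polyOver_coefs_in.
- exact/primitive_polyP.
- exact/polyOver_coefs_in.
- exact/primitive_polyP.
Qed.

Lemma nagata_subring : subring (nagata R).
Proof.
have [RD RM _] := coefs_in_ideal rR (subring_is_ideal rR).
have R1 := primitive_at1 rR.
apply/subringP; split.
- apply/nagataP; exists 1, 1; split=> //; first by case: R1.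
  by rewrite divr1.
- move=> x y /nagataP[p [q [Rp Rq ->]]] /nagataP[p' [q' [Rp' Rq' ->]]].
  apply/nagataP; exists (p * q' + (- 1)%:P * (p' * q)), (q * q'); split.
  + apply: (RD); apply: (RM) => //; first by case: Rq'.
      apply: coefs_in_C; first exact: subring0.
      by apply: subringN => //; exact: subring1.
    by apply: (RM) => //; case: Rq.
  + exact: primitive_atM.
  + have q0 := primitive_at_neq0 Rq; have q0' := primitive_at_neq0 Rq'.
    rewrite polyCN mulN1r tofracB !tofracM -mulNr addf_div ?tofrac_eq0 //.
    by rewrite mulNr.
- move=> x y /nagataP[p [q [Rp Rq ->]]] /nagataP[p' [q' [Rp' Rq' ->]]].
  apply/nagataP; exists (p * p'), (q * q'); split.
  + exact: RM.
  + exact: primitive_atM.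
  + have q0 := primitive_at_neq0 Rq; have q0' := primitive_at_neq0 Rq'.
    by rewrite !tofracM mulf_div.
Qed.

Lemma nagata_constant x : R x -> nagata R (constant x).
Proof.
move=> Rx; apply/nagataP; exists x%:P, 1; split.
- by apply: coefs_in_C => //; exact: subring0.
- exact: primitive_at1.
- by rewrite tofrac1 divr1.
Qed.

(* n R(t), see [nagata_ext_generated]. *)
Definition nagata_ext : set {fraction {poly K}} := [set z |
  exists p q, [/\ coefs_in n p, primitive_at R q & z = p%:F / q%:F]].

Lemma nagata_ext_ideal : is_ideal (nagata R) nagata_ext.
Proof.
have [nD nM n0] := coefs_in_ideal rR idn.
split.
- move=> _ [p [q [np Rq ->]]]; apply/nagataP; exists p, q; split=> //.
  by move=> i; exact: ideal_subset idn _ _.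
- exists 0, 1; split=> //; first exact: primitive_at1.
  by rewrite tofrac0 mul0r.
- move=> _ _ [p [q [np Rq ->]]] [p' [q' [np' Rq' ->]]].
  exists (q' * p + q * p'), (q * q'); split.
  + by apply: (nD); apply: (nM) => //; [case: Rq'|case: Rq].
  + exact: primitive_atM.
  + have q0 := primitive_at_neq0 Rq; have q0' := primitive_at_neq0 Rq'.
    by rewrite [q' * p]mulrC [q * p']mulrC tofracD !tofracM addf_div ?tofrac_eq0.
- move=> a _ /nagataP[p [q [np Rq ->]]] [p' [q' [np' Rq' ->]]].
  exists (p * p'), (q * q'); split.
  + exact: nM.
  + exact: primitive_atM.
  + have q0 := primitive_at_neq0 Rq; have q0' := primitive_at_neq0 Rq'.
    by rewrite !tofracM mulf_div.
Qed.

Lemma nagata_ext_constant x : n x -> nagata_ext (constant x).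
Proof.
move=> nx; exists x%:P, 1; split.
- by apply: coefs_in_C => //; exact: ideal_zero idn.
- exact: primitive_at1.
- by rewrite tofrac1 divr1.
Qed.

(** A fraction [p / q] splits into products of a coefficient of [p], a constant from [n], with
    ['X^i / q], an element of R(t). *)
Lemma nagata_ext_generated :
  nagata_ext = generated_ideal (nagata R) [set constant x | x in n].
Proof.
have rRt := nagata_subring.
have sub : [set constant x | x in n] `<=` nagata_ext.
  by move=> _ [x nx <-]; exact: nagata_ext_constant.
apply/seteqP; split; last first.
  by apply: generated_ideal_sub => //; exact: nagata_ext_ideal.
move=> _ [p [q [np Rq ->]]].
have subR : [set constant x | x in n] `<=` nagata R.
  by move=> z /sub; exact: ideal_subset nagata_ext_ideal _.
have idg := generated_ideal_ideal rRt subR.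
rewrite -[p]coefK poly_def raddf_sum mulr_suml; apply: (ideal_sum idg) => i _.
rewrite -mul_polyC /= tofracM -mulrA; apply: (ideal_mulr idg); last first.
  by apply: sub_generated_ideal; exists p`_i.
by apply/nagataP; exists 'X^i, q; split=> //; exact: coefs_in_Xn.
Qed.

(* [R(t)] is faithfully flat over [R]. *)
Lemma nagata_ext_contract x : nagata_ext (constant x) -> n x.
Proof.
move=> [p [q [np Rq e]]]; have [_ [i [_ qi0 Rqi]]] := Rq.
have q0 := primitive_at_neq0 Rq.
have : (x%:P * q)%:F = p%:F.
  by rewrite tofracM; move: e; rewrite /constant => ->; rewrite divfK ?tofrac_eq0.
move/eqP; rewrite tofrac_eq => /eqP/(congr1 (fun r : {poly K} => r`_i)).
rewrite coefCM => e'; have -> : x = (q`_i)^-1 * p`_i by rewrite -e' mulrC mulfK.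
exact: (ideal_mull idn).
Qed.

End NagataLocal.

Lemma nagata_ext_sub (K : fieldType) (R R' n n' : set K) :
  R `<=` R' -> n `<=` n' -> nagata_ext R n `<=` nagata_ext R' n'.
Proof.
move=> RR' nn' _ [p [q [np [Rq [i [Rqi qi0 Rqi']]] ->]]].
exists p, q; split=> //; first by move=> j; exact/nn'/np.
split; first by move=> j; exact/RR'/Rq.
by exists i; split=> //; exact: RR'.
Qed.

(** * The projective model *)

Section GeneratedSubring.
Variables (L : comNzRingType) (G : set L).

Lemma generated_subring_subring : subring (generated_subring G).
Proof.
apply/subringP; split.
- by move=> A [rA _]; exact: subring1.
- by move=> x y Gx Gy A AG; apply: (subringB AG.1); [exact: Gx|exact: Gy].
- by move=> x y Gx Gy A AG; apply: (subringM AG.1); [exact: Gx|exact: Gy].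
Qed.

Lemma generated_subring_sub A : subring A -> G `<=` A ->
  generated_subring G `<=` A.
Proof. by move=> rA GA x; apply. Qed.

Lemma sub_generated_subring : G `<=` generated_subring G.
Proof. exact: sub_smallest. Qed.

End GeneratedSubring.

(* What is used of a domain [D] with fraction field [K] and of a nonzero ideal
   [I] of [D] generated by [gens]. *)
Record blowup_data (K : fieldType) (D I : set K) (gens : seq K) : Prop := {
  bd_subring : subring D;
  bd_frac : forall z, exists x y, [/\ D x, D y, y != 0 & z = x / y];
  bd_gens : [set` gens] `<=` I;
  bd_ind : forall S : set K, S 0 -> (forall x y, S x -> S y -> S (x + y)) ->
    (forall d x, D d -> S x -> S (d * x)) -> [set` gens] `<=` S -> I `<=` S;
  bd_neq0 : exists2 x, I x & x != 0 }.

Section Model.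
Variables (K : fieldType) (D I : set K) (gens : seq K).
Hypothesis bd : blowup_data D I gens.

Local Notation X := (projective_model D I).
Local Notation chart := (chart_ring D I).

(* [I R = a R], expressed so that it makes sense for any set [R]. *)
Definition local_gen (R : set K) a := [/\ I a, a != 0 & forall y, I y -> R (y / a)].

Lemma chart_subring a : subring (chart a).
Proof. exact: generated_subring_subring. Qed.

Lemma chart_D a : D `<=` chart a.
Proof. by move=> x Dx; apply: sub_generated_subring; left. Qed.

Lemma chart_ratio a y : I y -> chart a (y / a).
Proof. by move=> Iy; apply: sub_generated_subring; right; exists y. Qed.

Lemma chart_sub a (A : set K) : subring A -> D `<=` A ->
  (forall y, I y -> A (y / a)) -> chart a `<=` A.
Proof.
move=> rA DA IA; apply: generated_subring_sub => // x [/DA//|[y Iy <-]].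
exact: IA.
Qed.

Lemma model_chart R : X R -> exists a, [/\ I a, a != 0 & local_rings (chart a) R].
Proof. by rewrite /projective_model => -[a [Ia a0] aR]; exists a. Qed.

Lemma chart_model a R : I a -> a != 0 -> local_rings (chart a) R -> X R.
Proof. by move=> Ia a0 aR; exists a. Qed.

Lemma model_local R : X R -> local_subring R.
Proof.
by move=> /model_chart[a [_ _]]; apply: local_rings_local; exact: chart_subring.
Qed.

Lemma model_subring R : X R -> subring R.
Proof. by move=> /model_local[]. Qed.

Lemma model_D R : X R -> D `<=` R.
Proof.
move=> /model_chart[a [_ _ aR]] x /(@chart_D a _).
by apply: (local_rings_sub _ aR); exact: chart_subring.
Qed.

Lemma local_rings_gen a R : I a -> a != 0 -> local_rings (chart a) R ->
  local_gen R a.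
Proof.
move=> Ia a0 aR; split=> // y /(@chart_ratio a _).
by apply: (local_rings_sub _ aR); exact: chart_subring.
Qed.

Lemma model_gen R : X R -> exists a, local_gen R a.
Proof. by move=> /model_chart[a [Ia a0 aR]]; exists a; exact: local_rings_gen. Qed.

Lemma local_gen_unit R a b : local_gen R a -> local_gen R b -> unit_in R (a / b).
Proof.
move=> [Ia a0 Ra] [Ib b0 Rb]; split; first exact: Rb.
  by rewrite mulf_neq0 // invr_eq0.
by rewrite invf_div; exact: Ra.
Qed.

(** The point comes from some [chart b]. As [a] and [b] both generate [I R], the quotient [b / a] is
    a unit of [R], and its powers carry fractions over [chart b] to fractions over [chart a]. *)
Lemma local_gen_rings a R : X R -> local_gen R a -> local_rings (chart a) R.
Proof.
move=> XR genRa; have [Ia a0 Ra] := genRa.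
have locR := model_local XR; have rR := locR.1.
have chR : chart a `<=` R by apply: chart_sub => //; exact: model_D.
have rch := chart_subring a.
pose P := [set x | chart a x /\ ~ unit_in R x].
have primeP : prime_ideal (chart a) P.
  split.
  - split.
    + by move=> x [].
    + by split; [exact: (subring0 rch)|move=> [_]; rewrite eqxx].
    + move=> x y [cx nx] [cy ny]; split; first exact: (subringD rch).
      by move/(locR.2 _ _ (chR _ cx) (chR _ cy)) => [].
    + move=> x y cx [cy ny]; split; first exact: (subringM rch).
      by rewrite mulrC => /(unit_in_factor rR (chR _ cy) (chR _ cx)).
  - by move=> [_]; apply; exact: unit_in1.
  - move=> x y cx cy [_ nxy]; apply: contrapT => /not_orP[nx ny]; apply: nxy.
    apply: unit_inM => //; apply: contrapT => nu; first exact: nx.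
    exact: ny.
have [b [Ib b0 [Q primeQ RE]]] := model_chart XR.
have genRb : local_gen R b by apply: local_rings_gen => //; exists Q.
have uba := local_gen_unit genRb genRa.
have ba0 : b / a != 0 by case: uba.
have rchb := chart_subring b.
(* The elements with this property form a subring, since exponents can be raised within [chart a];
   for the generators, [b / a * (y / b) = y / a]. *)
have clear x : chart b x -> exists N, chart a ((b / a) ^+ N * x).
  pose S := [set x | exists N, chart a ((b / a) ^+ N * x)].
  have mono y N M : chart a ((b / a) ^+ N * y) -> chart a ((b / a) ^+ (M + N) * y).
    move=> cy; rewrite exprD -mulrA; apply: (subringM rch) => //.
    by apply: (subringX rch); exact: chart_ratio.
  apply: (chart_sub (A := S)).
  - apply/subringP; split.
    + by exists 0%N; rewrite mul1r; exact: (subring1 rch).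
    + move=> y z [N cy] [M cz]; exists (M + N)%N.
      by rewrite mulrBr; apply: (subringB rch); [exact: mono|rewrite addnC; exact: mono].
    + move=> y z [N cy] [M cz]; exists (M + N)%N.
      have -> : (b / a) ^+ (M + N) * (y * z) =
          ((b / a) ^+ N * y) * ((b / a) ^+ M * z) by rewrite exprD; ring.
      exact: (subringM rch).
  - by move=> d Dd; exists 0%N; rewrite mul1r; exact: chart_D.
  - move=> y Iy; exists 1%N; rewrite expr1.
    have -> : b / a * (y / b) = y / a by field; rewrite ?a0 ?b0.
    exact: chart_ratio.
exists P => //; apply/seteqP; split.
  move=> _ [x [s [cx cs nPs ->]]]; have [_ _ Rs] : unit_in R s.
    by apply: contrapT => nu; apply: nPs.
  by apply: subringM => //; exact: chR.
move=> z Rz; move: (Rz); rewrite -{1}RE => -[x [s [cx cs nQs zE]]].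
have us : unit_in R s by rewrite -RE; exact: localization_unit.
have [[N cxN] [M csM]] := (clear _ cx, clear _ cs).
exists ((b / a) ^+ (M + N) * x), ((b / a) ^+ (M + N) * s); split.
- rewrite exprD -mulrA; apply: (subringM rch) => //.
  by apply: (subringX rch) => //; exact: chart_ratio.
- rewrite addnC exprD -mulrA; apply: (subringM rch) => //.
  by apply: (subringX rch) => //; exact: chart_ratio.
- move=> [_]; apply; apply: unit_inM => //; exact: unit_inX.
- rewrite zE invfM mulrACA divff ?mul1r //.
  by rewrite expf_eq0 (negbTE ba0) andbF.
Qed.

(** If no member of [gens] generated [I R], all the quotients [b / a] would be nonunits of [R], and
    by linearity so would [a / a = 1]. *)
Lemma local_gen_gens R a : X R -> local_gen R a ->
  exists2 b, b \in gens & local_gen R b.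
Proof.
move=> XR [Ia a0 Ra]; have locR := model_local XR; have rR := locR.1.
have DR := model_D XR.
apply: contrapT => nob.
pose S := [set x | R (x / a) /\ ~ unit_in R (x / a)].
have : S a; last by move=> [_]; apply; rewrite divff //; exact: unit_in1.
apply: (bd_ind bd) Ia.
- by rewrite /S/= mul0r; split; [exact: subring0|move=> [_]; rewrite eqxx].
- move=> x y [Rx nx] [Ry ny]; split; rewrite mulrDl; first exact: subringD.
  by move/(locR.2 _ _ Rx Ry) => [].
- move=> d x Dd [Rx nx]; split; rewrite -mulrA.
    by apply: subringM => //; exact: DR.
  by rewrite mulrC => /(unit_in_factor rR Rx (DR _ Dd)).
- move=> b gb; have Ib := bd_gens bd gb; split; first exact: Ra.
  move=> [_ ba0 Rba]; apply: nob; exists b => //.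
  have b0 : b != 0 by apply: contraNneq ba0 => ->; rewrite mul0r.
  split=> // y Iy; have -> : y / b = (y / a) * (b / a)^-1.
    by field; rewrite ?a0 ?b0.
  by apply: subringM => //; exact: Ra.
Qed.

(** By linearity it suffices to test the generators; hence the locus where [a] generates [I] is
    Zariski open. *)
Lemma local_gen_nbhd R a : X R -> I a -> a != 0 ->
  [set` [seq y / a | y <- gens]] `<=` R -> local_gen R a.
Proof.
move=> XR Ia a0 aR; split=> // y; move: y.
have rR := model_subring XR; apply: (bd_ind bd).
- by rewrite mul0r; exact: subring0.
- by move=> x y Rx Ry; rewrite mulrDl; exact: subringD.
- move=> d x Dd Rx; rewrite -mulrA; apply: subringM => //.
  exact: (model_D XR).
- by move=> y gy; apply: aR; apply: map_f.
Qed.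

(** The generic point, given by the zero prime of a chart. It lies in every nonempty open set, and a
    form that does not vanish there is a nonzero polynomial. *)
Lemma model_generic : X [set: K].
Proof.
have [a Ia a0] := bd_neq0 bd; apply: (chart_model Ia a0).
have rch := chart_subring a.
exists [set 0]; last first.
  apply/seteqP; split=> // z _; have [x [y [Dx Dy y0 ->]]] := bd_frac bd z.
  by exists x, y; split=> //; [exact: chart_D|exact: chart_D|exact/eqP].
split.
- split=> //.
  + by move=> _ ->; exact: subring0.
  + by move=> _ _ -> ->; rewrite addr0.
  + by move=> x _ _ ->; rewrite mulr0.
- by move/eqP; rewrite oner_eq0.
- move=> x y _ _ /= /eqP; rewrite mulf_eq0 => /orP[]/eqP; by [left|right].
Qed.

(** By [local_gen_gens] the charts of the finitely many generators cover the model, and each of them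
    is affine, hence quasi-compact. *)
Lemma model_quasi_compact (T : set (set K) -> Prop) :
  T set0 -> (forall V W, V `<=` W -> T W -> T V) ->
  (forall V W, T V -> T W -> T (V `|` W)) ->
  (forall R, X R -> exists2 F : seq K, [set` F] `<=` R &
     T (X `&` [set R' | [set` F] `<=` R'])) ->
  T X.
Proof.
move=> T0 Tsub TU Tloc.
have Tgens (s : seq K) : [set` s] `<=` I ->
    T (X `&` [set R | exists2 a, a \in s & local_gen R a]).
  elim: s => [|a s IHs] sI.
    by apply: Tsub T0 => R [_ []].
  have {}IHs := IHs (fun x (xs : x \in s) => sI x (mem_behead (s := a :: s) xs)).
  have Ia : I a by apply: sI; rewrite /= inE eqxx.
  suff Ta : T (X `&` [set R | local_gen R a]).
    apply: Tsub (TU _ _ Ta IHs) => R [XR [b]].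
    by rewrite inE => /predU1P[->|bs] genb; [left|right; split=> //; exists b].
  (* The list [gens] may contain 0, whose locus is empty. *)
  have [a0|a0] := eqVneq a 0.
    by apply: Tsub T0 => R [_ [_]]; rewrite a0 eqxx.
  apply: (@Tsub _ (local_rings (chart a))).
    by move=> R [XR genRa]; exact: local_gen_rings.
  apply: local_rings_quasi_compact => //; first exact: chart_subring.
  move=> R aR; have [F FR TF] := Tloc R (chart_model Ia a0 aR).
  exists F => //; apply: Tsub TF => R' [aR' FR']; split=> //.
  exact: (chart_model Ia a0 aR').
apply: Tsub (Tgens gens (bd_gens bd)) => R XR; split=> //.
by have [a genRa] := model_gen XR; exact: local_gen_gens genRa.
Qed.

End Model.

(** * Forms: polynomials over the sections of O(N) *)

Section Forms.
Variables (K : fieldType) (D I : set K) (gens : seq K).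
Hypothesis bd : blowup_data D I gens.

Local Notation X := (projective_model D I).
Local Notation chart := (chart_ring D I).
Local Notation "p %:F" := (tofrac p).

(* The global sections of the sheaf O(N) = I^N O, as a subset of [K]. *)
Definition twist N : set K :=
  [set y | forall R a, X R -> local_gen I R a -> R (y / a ^+ N)].

Lemma twist0 N : twist N 0.
Proof.
by move=> R a XR _; rewrite mul0r; apply: subring0; exact: (model_subring XR).
Qed.

Lemma twistB N x y : twist N x -> twist N y -> twist N (x - y).
Proof.
move=> tx ty R a XR g; rewrite mulrBl; apply: (subringB (model_subring XR)).
  exact: tx.
exact: ty.
Qed.

Lemma twistN N x : twist N x -> twist N (- x).
Proof. by rewrite -sub0r; apply: twistB; exact: twist0. Qed.

Lemma twistD N x y : twist N x -> twist N y -> twist N (x + y).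
Proof. by move=> tx ty; rewrite -[y]opprK; apply: twistB => //; exact: twistN. Qed.

Lemma twistM N M x y : twist N x -> twist M y -> twist (N + M) (x * y).
Proof.
move=> tx ty R a XR g; rewrite exprD -mulf_div.
by apply: (subringM (model_subring XR)); [exact: tx|exact: ty].
Qed.

Lemma twist_sum N (T : Type) (s : seq T) (P : pred T) (F : T -> K) :
  (forall i, P i -> twist N (F i)) -> twist N (\sum_(i <- s | P i) F i).
Proof. by move=> tF; apply: big_ind => //; [exact: twist0|exact: twistD]. Qed.

Lemma twist_D x : D x -> twist 0 x.
Proof. by move=> Dx R a XR _; rewrite expr0 divr1; exact: (model_D XR). Qed.

Lemma twist_I x : I x -> twist 1 x.
Proof. by move=> Ix R a XR [_ _]; rewrite expr1; apply. Qed.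

Lemma twistX N M x : twist N x -> twist (N * M) (x ^+ M).
Proof.
move=> tx; elim: M => [|M IHM].
  by rewrite muln0 expr0; apply: twist_D; exact: subring1 (bd_subring bd).
by rewrite exprS mulnS; exact: twistM.
Qed.

Lemma twist_raise a N M x : I a ->
  twist N (a ^+ N * x) -> twist (M + N) (a ^+ (M + N) * x).
Proof.
move=> Ia tx; rewrite exprD -mulrA; apply: twistM => //.
by rewrite -[X in twist X]mul1n; apply: twistX; exact: twist_I.
Qed.

(** A function on the chart is a global section of O(N) divided by [a ^+ N]: such quotients form a
    subring containing [D] and the [y / a]. *)
Lemma chart_twist a x : I a -> chart a x -> exists N, twist N (a ^+ N * x).
Proof.
(* With [a = 0] the exponent 1 makes the product 0. *)
move=> Ia; have [->|a0] := eqVneq a 0.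
  by move=> _; exists 1%N; rewrite mul0r; exact: twist0.
pose S := [set x | exists N, twist N (a ^+ N * x)].
apply: (chart_sub (A := S)).
- apply/subringP; split.
  + by exists 0%N; rewrite mul1r; apply: twist_D; exact: subring1 (bd_subring bd).
  + move=> y z [N cy] [M cz]; exists (M + N)%N; rewrite mulrBr; apply: twistB.
      exact: twist_raise.
    by rewrite addnC; exact: twist_raise.
  + move=> y z [N cy] [M cz]; exists (N + M)%N.
    have -> : a ^+ (N + M) * (y * z) = (a ^+ N * y) * (a ^+ M * z).
      by rewrite exprD; ring.
    exact: twistM.
- by move=> d Dd; exists 0%N; rewrite mul1r; exact: twist_D.
- move=> y Iy; exists 1%N; rewrite expr1.
  have -> : a * (y / a) = y by field.
  exact: twist_I.
Qed.

Lemma chart_twist_seq a (s : seq K) : I a -> [set` s] `<=` chart a ->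
  exists N, forall x, x \in s -> twist N (a ^+ N * x).
Proof.
move=> Ia; elim: s => [|x s IHs] sa; first by exists 0%N.
have [|N tN] := IHs.
  by move=> y ys; apply: sa; rewrite /= inE (ys : y \in s) orbT.
have [|M tM] := chart_twist Ia (x := x).
  by apply: sa; rewrite /= inE eqxx.
exists (N + M)%N => y; rewrite inE => /predU1P[->|/tN ty].
  exact: twist_raise.
by rewrite addnC; exact: twist_raise.
Qed.

(* The nonvanishing loci of sections of O(N) form a basis of the topology. *)
Lemma twist_denom R a (F : seq K) : X R -> local_gen I R a ->
  [set` F] `<=` R ->
  exists N c, [/\ twist N c, unit_in R (c / a ^+ N)
                & forall x, x \in F -> twist N (c * x)].
Proof.
move=> XR genRa; have [Ia a0 _] := genRa.
have [P primeP <-] := local_gen_rings XR genRa.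
have rch := chart_subring D I a.
move=> /(localization_denom rch primeP)[g [Ag Pg gF]].
have [|N tN] := chart_twist_seq (s := g :: [seq g * x | x <- F]) Ia.
  move=> x; rewrite /= inE => /predU1P[-> //|/mapP[y yF ->]].
  exact: gF.
exists N, (a ^+ N * g); split.
- by apply: tN; rewrite inE eqxx.
- rewrite mulrC mulKf ?expf_neq0 //; exact: localization_unit.
- by move=> x xF; rewrite -mulrA; apply: tN; rewrite inE map_f ?orbT.
Qed.

Definition twform N (q : {poly K}) := coefs_in (twist N) q.

(* The coefficients of the form [q] of degree [N] generate [I^N R]; as [R] is
   local, one of them is then a generator. *)
Definition nonvanishing N (q : {poly K}) : set (set K) :=
  [set R | exists i a, local_gen I R a /\ unit_in R (q`_i / a ^+ N)].

Lemma nonvanishing_neq0 N q R : nonvanishing N q R -> q != 0.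
Proof.
by move=> [i [a [_ [_ + _]]]]; apply: contra_neq => ->; rewrite coef0 mul0r.
Qed.

Lemma twform_coefs N q R a : X R -> local_gen I R a -> twform N q ->
  coefs_in R ((a ^+ N)^-1 *: q).
Proof. by move=> XR g fq i; rewrite coefZ mulrC; exact: fq. Qed.

(** Two generators of [I R] differ by a unit, so the generator occurring in [nonvanishing] can be
    replaced by any other. *)
Lemma nonvanishingP N q R a : X R -> local_gen I R a -> twform N q ->
  nonvanishing N q R <-> primitive_at R ((a ^+ N)^-1 *: q).
Proof.
move=> XR g fq; have [_ a0 _] := g; have rR := model_subring XR; split; last first.
  by move=> [_ [i]]; rewrite coefZ mulrC => u; exists i, a.
move=> [i [b [gb u]]]; split; first exact: twform_coefs.
have [_ b0 _] := gb; exists i; rewrite coefZ.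
have -> : (a ^+ N)^-1 * q`_i = q`_i / b ^+ N * (b / a) ^+ N.
  by rewrite expr_div_n [RHS]mulrA divfK ?expf_neq0 // mulrC.
by apply: unit_inM => //; apply: unit_inX => //; exact: (local_gen_unit gb g).
Qed.

Lemma twformM N M p q : twform N p -> twform M q -> twform (N + M) (p * q).
Proof.
by move=> fp fq i; rewrite coefM; apply: twist_sum => j _; exact: twistM.
Qed.

Lemma twformD N p q : twform N p -> twform N q -> twform N (p + q).
Proof. by move=> fp fq i; rewrite coefD; exact: twistD. Qed.

Lemma twformMXn N M p : twform N p -> twform N (p * 'X^M).
Proof.
by move=> fp i; rewrite coefMXn; case: ifP => _; [exact: twist0|exact: fp].
Qed.

Lemma twformC N c : twist N c -> twform N c%:P.
Proof. by move=> tc i; rewrite coefC; case: ifP => // _; exact: twist0. Qed.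

Lemma twformX N M p : twform N p -> twform (N * M) (p ^+ M).
Proof.
move=> fp; elim: M => [|M IHM].
  by rewrite muln0; apply: twformC; apply: twist_D; exact: subring1 (bd_subring bd).
by rewrite exprS mulnS; exact: twformM.
Qed.

Lemma nonvanishingM N M p q R : X R -> twform N p -> twform M q ->
  nonvanishing N p R -> nonvanishing M q R -> nonvanishing (N + M) (p * q) R.
Proof.
move=> XR fp fq np nq; have [a g] := model_gen XR.
apply/(nonvanishingP XR g (twformM fp fq)).
rewrite exprD invfM -scalerA scalerAr scalerAl.
by apply: (primitive_atM (model_local XR)); exact/nonvanishingP.
Qed.

Lemma nonvanishingX N M p R : X R -> twform N p ->
  nonvanishing N p R -> nonvanishing (N * M) (p ^+ M) R.
Proof.
move=> XR fp np; elim: M => [|M IHM].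
  have [a g] := model_gen XR; rewrite muln0; exists 0%N, a; split=> //.
  by rewrite coefC !expr0 divr1; exact: unit_in1 (model_subring XR).
by rewrite exprS mulnS; apply: nonvanishingM => //; exact: twformX.
Qed.

Lemma nonvanishingC N c R a : local_gen I R a -> unit_in R (c / a ^+ N) ->
  nonvanishing N c%:P R.
Proof. by move=> g u; exists 0%N, a; rewrite coefC. Qed.

(** Since [size p <= M], the shift keeps the coefficients of [p] and [q] apart, and nothing
    cancels. *)
Lemma nonvanishing_spreadl N M (p q : {poly K}) : (size p <= M)%N ->
  nonvanishing N p `<=` nonvanishing N (p + q * 'X^M).
Proof.
move=> szp R [i [a [g u]]]; exists i, a; split=> //.
have lti : (i < M)%N.
  apply: leq_trans szp; rewrite ltnNge; apply/negP => szi.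
  by case: u => _; rewrite nth_default // mul0r eqxx.
by rewrite coefD coefMXn lti addr0.
Qed.

Lemma nonvanishing_spreadr N M (p q : {poly K}) : (size p <= M)%N ->
  nonvanishing N q `<=` nonvanishing N (p + q * 'X^M).
Proof.
move=> szp R [i [a [g u]]]; exists (i + M)%N, a; split=> //.
rewrite coefD coefMXn ltnNge leq_addl /= addnK nth_default ?add0r //.
by rewrite (leq_trans szp) // leq_addl.
Qed.

(** The same coefficient witnesses nonvanishing as long as [a] generates [I] and the inverse of the
    quotient by [a ^+ N] stays in the ring; finitely many elements ensure both. *)
Lemma nonvanishing_open N q R : X R -> twform N q -> nonvanishing N q R ->
  exists2 F : seq K, [set` F] `<=` R &
    X `&` [set R' | [set` F] `<=` R'] `<=` nonvanishing N q.
Proof.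
move=> XR fq [i [a [g u]]]; have [Ia a0 Ra] := g; have [_ qi0 Rqi] := u.
exists ((q`_i / a ^+ N)^-1 :: [seq y / a | y <- gens]).
  move=> x; rewrite /= inE => /predU1P[-> //|/mapP[y gy ->]].
  by apply: Ra; exact: (bd_gens bd).
move=> R' [XR' /= FR'].
have g' : local_gen I R' a.
  apply: (local_gen_nbhd bd) => // x xF; apply: FR'.
  by rewrite /= inE (xF : x \in _) orbT.
exists i, a; split=> //; split=> //; first exact: fq.
by apply: FR'; rewrite /= inE eqxx.
Qed.

Lemma twform_frac N p q R : X R -> twform N p -> twform N q -> nonvanishing N q R ->
  nagata R (p%:F / q%:F).
Proof.
move=> XR fp fq nq; have [a g] := model_gen XR; have [_ a0 _] := g.
apply/(nagataP (model_local XR)).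
exists ((a ^+ N)^-1 *: p), ((a ^+ N)^-1 *: q); split.
- exact: twform_coefs.
- exact/nonvanishingP.
- rewrite -!mul_polyC !tofracM -mulf_div divff ?mul1r //.
  by rewrite tofrac_eq0 polyC_eq0 invr_eq0 expf_neq0.
Qed.

(** A common denominator [c] of the coefficients, a unit multiple of [a ^+ N] in [R], turns them
    into sections of O(N) and cancels in the quotient. *)
Lemma nagata_twform R z : X R -> nagata R z ->
  exists N p q, [/\ twform N p, twform N q, nonvanishing N q R & z = p%:F / q%:F].
Proof.
move=> XR /(nagataP (model_local XR))[p [q [Rp [Rq [i ui]] ->]]].
have [a g] := model_gen XR; have [_ a0 _] := g.
have [|N [c [tc uc cF]]] := twist_denom (F := (p : seq K) ++ q) XR g.
  by move=> x; rewrite /= mem_cat => /orP[] /(nthP 0)[j _ <-].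
exists N, (c *: p), (c *: q).
have fs (s : {poly K}) : {subset (s : seq K) <= (p : seq K) ++ q} ->
    twform N (c *: s).
  move=> sF j; rewrite coefZ; have [szj|szj] := ltnP j (size s).
    by apply: cF; apply: sF; exact: mem_nth.
  by rewrite nth_default // mulr0; exact: twist0.
split.
- by apply: fs => x xp; rewrite mem_cat xp.
- by apply: fs => x xp; rewrite mem_cat xp orbT.
- exists i, a; split=> //; rewrite coefZ mulrAC; apply: unit_inM => //.
  exact: model_subring XR.
- rewrite -!mul_polyC !tofracM -mulf_div divff ?mul1r //.
  rewrite tofrac_eq0 polyC_eq0.
  by move: uc => [_ + _]; apply: contraNneq => ->; rewrite mul0r.
Qed.

(* This form vanishes nowhere, and generates [I R(t)] for all [R]. *)
Definition gens_poly : {poly K} := Poly gens.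

Lemma gens_poly_twform : twform 1 gens_poly.
Proof.
move=> i; rewrite coef_Poly; have [szi|szi] := ltnP i (size gens).
  by apply: twist_I; apply: (bd_gens bd); exact: mem_nth.
by rewrite nth_default //; exact: twist0.
Qed.

Lemma gens_poly_nonvanishing : X `<=` nonvanishing 1 gens_poly.
Proof.
move=> R XR; have [a /(local_gen_gens bd XR)[b bg genRb]] := model_gen XR.
exists (index b gens), b; split=> //.
rewrite coef_Poly nth_index // expr1 divff; last by case: genRb.
exact: unit_in1 (model_subring XR).
Qed.

(* The two summands have no monomial in common, so that the content of the sum
   is the sum of the contents. *)
Definition completed N (q : {poly K}) := q + gens_poly ^+ N * 'X^(size q).

Lemma completed_twform N q : twform N q -> twform N (completed N q).
Proof.
move=> fq; apply: twformD => //; apply: twformMXn.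
by rewrite -[X in twform X]mul1n; apply: twformX; exact: gens_poly_twform.
Qed.

Lemma completed_nonvanishing N q : twform N q -> X `<=` nonvanishing N (completed N q).
Proof.
move=> fq R XR; apply: nonvanishing_spreadr => //.
rewrite -[N in nonvanishing N]mul1n; apply: nonvanishingX => //.
  exact: gens_poly_twform.
exact: gens_poly_nonvanishing.
Qed.

End Forms.

(** * Ideals of D^* *)

Section FieldIdentities.
Variable F : fieldType.
Implicit Types x y z s t u v : F.

Lemma divf_mul_divf x y z : x != 0 -> y != 0 -> z = y / x * (x / y * z).
Proof. by move=> x0 y0; field; rewrite ?x0 ?y0. Qed.

Lemma divf_cancel_inner (r : F) s t u z : r != 0 ->
  (r / t * u) * (s / r * z) = (s / t) * (u * z).
Proof.
move=> r0.
have -> : r / t * u * (s / r * z) = (r / r) * (s / t * (u * z)) by ring.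
by rewrite divff // mul1r.
Qed.

Lemma divf_cancel_left x y u v z : x != 0 ->
  (x * y * v) / (x * u) * z = v * (y / u * z).
Proof.
move=> x0; rewrite invfM.
have -> : x * y * v * (x^-1 * u^-1) * z = (x / x) * (v * (y / u * z)) by ring.
by rewrite divff // mul1r.
Qed.
End FieldIdentities.

Section Star.
Variables (K : fieldType) (D I : set K) (gens : seq K).
Hypothesis bd : blowup_data D I gens.

Local Notation X := (projective_model D I).
Local Notation star := (nagata_star D I).
Local Notation "p %:F" := (tofrac p).
Local Notation twform := (twform D I).
Local Notation nonvanishing := (nonvanishing I).
Local Notation completed := (completed gens).

Lemma star_sub R : X R -> star `<=` nagata R.
Proof. by move=> XR z; apply. Qed.

Lemma star_frac N p q : twform N p -> twform N q -> X `<=` nonvanishing N q ->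
  star (p%:F / q%:F).
Proof. by move=> fp fq nq R XR; exact: (twform_frac XR fp fq (nq _ XR)). Qed.

Lemma star_Xn m : star ('X^m)%:F.
Proof.
have f1 : twform 0 1.
  by apply: twformC; apply: twist_D; exact: subring1 (bd_subring bd).
rewrite -[X in star X]divr1 -tofrac1 -['X^m]mul1r; apply: (star_frac (N := 0)) => //.
  exact: twformMXn.
(* The form 1 of degree 0 vanishes nowhere, being the zeroth power of [gens_poly gens]. *)
move=> R XR; have := nonvanishingX bd 0 XR (gens_poly_twform bd).
by rewrite expr0 muln0; apply; exact: (gens_poly_nonvanishing bd).
Qed.

Variable J : set {fraction {poly K}}.
Hypothesis idJ : is_ideal star J.

(* The extension of [J] to [R(t)] is its localization: the denominator [q] of
   an element of [R(t)] becomes the unit [q / completed q] of [R(t)], which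
   belongs to D^* together with all the other quotients by [completed q]. *)
Lemma generated_star_idealP R z : X R ->
  generated_ideal (nagata R) J z <-> exists N q q',
    [/\ twform N q, twform N q', nonvanishing N q R, X `<=` nonvanishing N q'
      & J (q%:F / q'%:F * z)].
Proof.
move=> XR; have rRt := nagata_subring (model_local XR).
have JRt : J `<=` nagata R by move=> x /(ideal_subset idJ); exact: star_sub.
have idg := generated_ideal_ideal rRt JRt.
have nz N q : nonvanishing N q R -> q%:F != 0.
  by move=> /nonvanishing_neq0; rewrite tofrac_eq0.
split; last first.
  move=> [N [q [q' [fq fq' nq nq' Jz]]]].
  have q0 := nz _ _ nq; have q'0 := nz _ _ (nq' _ XR).
  have -> : z = (q'%:F / q%:F) * (q%:F / q'%:F * z).
    exact: (divf_mul_divf _ q0 q'0).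
  apply: (ideal_mull idg); first exact: twform_frac XR fq' fq nq.
  exact: sub_generated_ideal.
(* [E] is shown to be an ideal of R(t) containing [J]; for a sum, the two multipliers are
   multiplied. *)
move: z; pose E := [set z | exists N q q',
    [/\ twform N q, twform N q', nonvanishing N q R, X `<=` nonvanishing N q'
      & J (q%:F / q'%:F * z)]].
apply: (generated_ideal_sub (J := E)); last first.
  move=> z Jz; exists 1%N, (gens_poly gens), (gens_poly gens).
  have fg := gens_poly_twform bd; have ng := gens_poly_nonvanishing bd.
  split=> //; first exact: ng.
  by rewrite divff ?mul1r //; apply: nz; exact: ng.
split.
- move=> z [N [q [q' [fq fq' nq nq' Jz]]]].
  have q0 := nz _ _ nq; have q'0 := nz _ _ (nq' _ XR).
  have -> : z = (q'%:F / q%:F) * (q%:F / q'%:F * z).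
    exact: (divf_mul_divf _ q0 q'0).
  apply: (subringM rRt); first exact: twform_frac XR fq' fq nq.
  exact: JRt.
- exists 1%N, (gens_poly gens), (gens_poly gens).
  have fg := gens_poly_twform bd; have ng := gens_poly_nonvanishing bd.
  by split=> //; [exact: ng|rewrite mulr0; exact: ideal_zero idJ].
- move=> z w [N [q [q' [fq fq' nq nq' Jz]]]] [M [r [r' [fr fr' nr nr' Jw]]]].
  exists (N + M)%N, (q * r), (q' * r'); split.
  + exact: twformM.
  + exact: twformM.
  + exact: (nonvanishingM XR fq fr nq nr).
  + by move=> S XS; exact: (nonvanishingM XS fq' fr' (nq' _ XS) (nr' _ XS)).
  + rewrite !tofracM -mulf_div mulrDr; apply: (ideal_add idJ).
      rewrite mulrAC; apply: (ideal_mulr idJ) => //.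
      exact: star_frac fr fr' nr'.
    rewrite -(mulrA (q%:F / q'%:F)); apply: (ideal_mull idJ) => //.
    exact: star_frac fq fq' nq'.
- move=> a z /(nagata_twform bd XR)[M [s [r [fs fr nr ->]]]].
  move=> [N [q [q' [fq fq' nq nq' Jz]]]].
  have fr' := completed_twform bd fr.
  have nr' := completed_nonvanishing bd fr.
  (* The factor [r / completed M r] cancels the denominator of [s / r], leaving [s / completed M r],
     an element of D^*, times an element of [J]. *)
  exists (M + N)%N, (r * q), (completed M r * q'); split.
  + exact: twformM.
  + exact: twformM.
  + exact: (nonvanishingM XR fr fq nr nq).
  + by move=> S XS; exact: (nonvanishingM XS fr' fq' (nr' _ XS) (nq' _ XS)).
  + rewrite !tofracM -mulf_div.
    rewrite (divf_cancel_inner _ _ _ _ (nz _ _ nr)).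
    apply: (ideal_mull idJ) => //.
    exact: star_frac fs fr' nr'.
Qed.

(** [T V] asks for a multiplier [p / q] of [z] into [J], with [q] nowhere vanishing and [p] not
    vanishing on [V]. Quasi-compactness provides one whose [p] vanishes nowhere, and then [q / p] is
    in D^*. *)
Lemma star_ideal_local z : star z ->
  (forall R, X R -> generated_ideal (nagata R) J z) -> J z.
Proof.
move=> sz Jz.
pose T V := exists N p q, [/\ twform N p, twform N q, X `<=` nonvanishing N q,
  J (p%:F / q%:F * z) & X `&` V `<=` nonvanishing N p].
have fg := gens_poly_twform bd; have ng := gens_poly_nonvanishing bd.
suff [N [p [q [fp fq nq Jpq np]]]] : T X.
  have {}np : X `<=` nonvanishing N p by move=> R XR; exact: np.
  have -> : z = (q%:F / p%:F) * (p%:F / q%:F * z).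
    have XK := model_generic bd.
    have p0 := nonvanishing_neq0 (np _ XK).
    have q0 := nonvanishing_neq0 (nq _ XK).
    by apply: divf_mul_divf; rewrite tofrac_eq0.
  by apply: (ideal_mull idJ) => //; exact: star_frac fq fp np.
apply: (model_quasi_compact bd).
- exists 1%N, 0, (gens_poly gens); split=> //.
  + by move=> i; rewrite coef0; exact: twist0.
  + by rewrite tofrac0 !mul0r; exact: ideal_zero idJ.
  + by rewrite setI0.
- move=> V W VW [N [p [q [fp fq nq Jpq np]]]]; exists N, p, q; split=> //.
  by move=> R [XR /VW WR]; exact: np.
- move=> V W [N [p [q [fp fq nq Jpq np]]]] [M [r [s [fr fs ns Jrs nr]]]].
  pose m := size (p * s).
  (* Over the common denominator [q * s] the numerators are [p * s] and [q * r]; after the shift of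
     the second, their sum does not vanish wherever one of [p] and [r] does not. *)
  exists (N + M)%N, (p * s + (q * r) * 'X^m), (q * s); split.
  + by apply: twformD; [exact: twformM|apply: twformMXn; exact: twformM].
  + exact: twformM.
  + by move=> R XR; exact: (nonvanishingM XR fq fs (nq _ XR) (ns _ XR)).
  + have XK := model_generic bd.
    have s0 := nonvanishing_neq0 (ns _ XK).
    have q0 := nonvanishing_neq0 (nq _ XK).
    rewrite tofracD !tofracM mulrDl mulrDl.
    apply: (ideal_add idJ).
      by rewrite -mulf_div divff ?tofrac_eq0 // mulr1.
    rewrite divf_cancel_left ?tofrac_eq0 //.
    by apply: (ideal_mull idJ) => //; exact: star_Xn.
  + move=> R [XR [VR|WR]].
      apply: nonvanishing_spreadl => //.
      by apply: (nonvanishingM XR fp fs); [exact: np|exact: ns].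
    apply: nonvanishing_spreadr => //.
    by apply: (nonvanishingM XR fq fr); [exact: nq|exact: nr].
- move=> R XR; have [N [q [q' [fq fq' nq nq' Jqz]]]] :=
    (generated_star_idealP z XR).1 (Jz R XR).
  have [F FR FV] := nonvanishing_open bd XR fq nq.
  exists F => //; exists N, q, q'; split=> //.
  by move=> S [_]; exact: FV.
Qed.

End Star.

(** * From relevant ideals to quasi-coherent families of stalks *)

Section Contraction.
Variables (K : fieldType) (D I : set K) (gens : seq K).
Hypothesis bd : blowup_data D I gens.

Local Notation X := (projective_model D I).
Local Notation chart := (chart_ring D I).
Local Notation star := (nagata_star D I).

(* J R(t) :&: R *)
Definition contraction (J : set {fraction {poly K}}) (R : set K) : set K :=
  [set x | R x /\ generated_ideal (nagata R) J (constant x)].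

Variable J : set {fraction {poly K}}.
Hypothesis relJ : relevant_ideal D I J.

Let idJ : is_ideal star J. Proof. by case: relJ. Qed.

Lemma generated_relevant_ideal R : X R ->
  is_ideal (nagata R) (generated_ideal (nagata R) J).
Proof.
move=> XR; apply: generated_ideal_ideal; first exact: nagata_subring (model_local XR).
by move=> z /(ideal_subset idJ); exact: star_sub.
Qed.

Lemma contraction_ideal R : X R -> is_ideal R (contraction J R).
Proof.
move=> XR; have rR := model_subring XR; have idg := generated_relevant_ideal XR.
split.
- by move=> x [].
- split; first exact: subring0.
  by rewrite /constant polyC0 tofrac0; exact: ideal_zero idg.
- move=> x y [Rx gx] [Ry gy]; split; first exact: subringD.
  by rewrite /constant polyCD tofracD; exact: (ideal_add idg).
- move=> a x Ra [Rx gx]; split; first exact: subringM.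
  rewrite /constant polyCM tofracM; apply: (ideal_mull idg) => //.
  exact: nagata_constant (model_local XR) _ Ra.
Qed.

(** Relevance says that the extension is generated by its constants from [R], and these are the
    elements of the contraction. *)
Lemma relevant_ext R : X R ->
  generated_ideal (nagata R) J = nagata_ext R (contraction J R).
Proof.
move=> XR; rewrite (nagata_ext_generated (model_local XR) (contraction_ideal XR)).
have [_ /(_ R XR)[_ {1}->]] := relJ.
congr (generated_ideal _ _); apply/seteqP; split.
  by move=> z [+ [x Rx xz]]; rewrite -xz => gx; exists x.
by move=> _ [x [Rx gx] <-]; split=> //; exists x.
Qed.

(** The multiplier [q / q'] that brings [x] into [J] serves at every point where [q] does not
    vanish. *)
Lemma contraction_open R x : X R -> contraction J R x ->
  exists2 F : seq K, [set` F] `<=` R &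
    forall R', X R' -> [set` F] `<=` R' -> contraction J R' x.
Proof.
move=> XR [Rx /(generated_star_idealP bd idJ _ XR)].
move=> [N [q [q' [fq fq' nq nq' Jqx]]]].
have [F FR FV] := nonvanishing_open bd XR fq nq.
exists (x :: F).
  by move=> y; rewrite /= inE => /predU1P[-> //|]; exact: FR.
move=> R' XR' FR'; split; first by apply: FR'; rewrite /= inE eqxx.
apply/(generated_star_idealP bd idJ _ XR'); exists N, q, q'; split=> //.
apply: FV; split=> // y yF; apply: FR'.
by rewrite /= inE (yF : y \in F) orbT.
Qed.

(* Otherwise some prime of [R] containing the conductor of [s] into the
   contraction avoids [f], which contradicts the hypothesis at this prime. *)
Lemma contraction_localization a f s R : I a -> a != 0 -> chart a f ->
  (forall R', local_rings (chart a) R' -> unit_in R' f -> contraction J R' s) ->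
  local_rings (chart a) R -> exists n, contraction J R (f ^+ n * s).
Proof.
move=> Ia a0 Af Ns AR; apply: contrapT => nN.
have XA R' : local_rings (chart a) R' -> X R' by exact: chart_model.
have rA := chart_subring D I a.
have XR := XA _ AR; have rR := model_subring XR.
have AsubR := local_rings_sub rA AR.
have idN := contraction_ideal XR.
have [Q primeQ RE] := AR; have [_ Q1 QM] := primeQ.
pose C := [set g | chart a g /\ contraction J R (g * s)].
(* A prime avoiding [S] contains no power of [f] and lies inside [Q]; so [f] is a unit of its local
   ring, which contains [R]. *)
pose S := [set z | exists n h, [/\ chart a h, ~ Q h & z = f ^+ n * h]].
have [||||x Cx [n [h [Ah Qh xE]]]|P primeP [CP PS]] :=
    @exists_prime_avoiding _ (chart a) rA C S.
- split.
  + by move=> g [].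
  + by split; [exact: (subring0 rA)|rewrite mul0r; exact: ideal_zero idN].
  + move=> g h [Ag Ng] [Ah Nh]; split; first exact: (subringD rA).
    by rewrite mulrDl; exact: (ideal_add idN).
  + move=> b g Ab [Ag Ng]; split; first exact: (subringM rA).
    by rewrite -mulrA; apply: (ideal_mull idN) => //; exact: AsubR.
- move=> _ [n [h [Ah _ ->]]]; apply: (subringM rA) => //.
  exact: (subringX rA).
- by exists 0%N, 1; split; rewrite ?mulr1 //; exact: (subring1 rA).
- move=> _ _ [n [h [Ah Qh ->]]] [m [k [Ak Qk ->]]]; exists (n + m)%N, (h * k).
  split; [exact: (subringM rA)|by move=> /(QM _ _ Ah Ak)[]|].
  by rewrite exprD; ring.
- case: Cx => _; rewrite xE mulrAC mulrC => Nhs; apply: nN; exists n.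
  have [_ h0 Rh] : unit_in R h by rewrite -RE; exact: localization_unit.
  have -> : f ^+ n * s = h^-1 * (h * (f ^+ n * s)) by rewrite mulKf.
  exact: (ideal_mull idN).
have nPf : ~ P f.
  by move/PS; apply; exists 1%N, 1; split; rewrite ?mulr1 //; exact: (subring1 rA).
have PQ h : chart a h -> ~ Q h -> ~ P h.
  by move=> Ah Qh /PS; apply; exists 0%N, h; rewrite mul1r.
pose R' := localization (chart a) P.
have AR' : local_rings (chart a) R' by exists P.
have XR' := XA _ AR'; have rR' := model_subring XR'.
have AsubR' := local_rings_sub rA AR'.
have RR' : R `<=` R'.
  by rewrite -RE => _ [x [h [Ax Ah Qh ->]]]; exists x, h; split=> //; exact: PQ.
have [idP P1 PM] := primeP.
(* The extension of [contraction J R] to the localization [R']. *)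
pose n' := [set z | R' z /\ exists h,
  [/\ chart a h, ~ P h & contraction J R (h * z)]].
have idn' : is_ideal R' n'.
  split.
  - by move=> z [].
  - split; first exact: subring0.
    by exists 1; split; rewrite ?mulr0; [exact: subring1|by []|exact: ideal_zero idN].
  - move=> z w [Rz [h [Ah Ph Nz]]] [Rw [k [Ak Pk Nw]]].
    split; first exact: subringD.
    exists (h * k); split; [exact: (subringM rA)|by move/(PM _ _ Ah Ak)=> []|].
    have -> : h * k * (z + w) = k * (h * z) + h * (k * w) by ring.
    by apply: (ideal_add idN); apply: (ideal_mull idN) => //; exact: AsubR.
  - move=> _ z [x [t [Ax At Pt ->]]] [Rz [h [Ah Ph Nz]]].
    have [_ t0 _] := localization_unit rA primeP At Pt.
    split; first by apply: subringM => //; exists x, t.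
    exists (t * h); split; [exact: (subringM rA)|by move/(PM _ _ At Ah)=> []|].
    have -> : t * h * (x / t * z) = x * (h * z) by field.
    by apply: (ideal_mull idN) => //; exact: AsubR.
have [_ Js] : contraction J R' s.
  by apply: Ns => //; exact: localization_unit.
(* By relevance [J] lies in the extension of [contraction J R] to R(t), hence in that of [n'] to
   R'(t). Contracting to [R'] puts [s] into [n']: some [h] outside [P] is in the conductor [C],
   which [P] contains. *)
have : n' s.
  apply: (nagata_ext_contract idn'); move: (constant s) Js.
  apply: generated_ideal_sub; first exact: nagata_ext_ideal (model_local XR') idn'.
  move=> z Jz; apply: (@nagata_ext_sub _ R _ (contraction J R)) => //.
    move=> x Nx; split; first by apply: RR'; case: Nx.
    by exists 1; split; rewrite ?mul1r //; exact: (subring1 rA).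
  by rewrite -relevant_ext //; exact: sub_generated_ideal.
by move=> [_ [h [Ah Ph Nh]]]; apply/Ph/CP.
Qed.

(** The exponent found at a point works in a neighbourhood, and quasi-compactness of the chart makes
    it uniform. *)
Lemma contraction_quasi_coherent a f s : I a -> a != 0 -> chart a f ->
  (forall R, local_rings (chart a) R -> unit_in R f -> contraction J R s) ->
  exists n, forall R, local_rings (chart a) R -> contraction J R (f ^+ n * s).
Proof.
move=> Ia a0 Af Ns.
have XA R' : local_rings (chart a) R' -> X R' by exact: chart_model.
have rA := chart_subring D I a.
have raise R n m : local_rings (chart a) R ->
    contraction J R (f ^+ n * s) -> contraction J R (f ^+ (m + n) * s).
  move=> AR Nn; rewrite exprD -mulrA.
  apply: (ideal_mull (contraction_ideal (XA _ AR))) => //.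
  by apply: (local_rings_sub rA AR); exact: (subringX rA).
pose T V := exists n, forall R, local_rings (chart a) R -> V R ->
  contraction J R (f ^+ n * s).
suff [n Tn] : T (local_rings (chart a)) by exists n => R AR; exact: Tn.
apply: local_rings_quasi_compact => //.
- by exists 0%N.
- by move=> V W VW [n Tn]; exists n => R AR /VW; exact: Tn.
- move=> V W [n Tn] [m Tm]; exists (n + m)%N => R AR [VR|WR].
    by rewrite addnC; apply: raise => //; exact: Tn.
  by apply: raise => //; exact: Tm.
- move=> R AR; have [n Nn] := contraction_localization Ia a0 Af Ns AR.
  have [F FR FN] := contraction_open (XA _ AR) Nn.
  by exists F => //; exists n => R' AR' [_ FR']; apply: FN => //; exact: XA.
Qed.

End Contraction.

(** * From quasi-coherent families of stalks to relevant ideals *)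

Section StalkFamily.
Variables (K : fieldType) (D I : set K) (gens : seq K).
Hypothesis bd : blowup_data D I gens.

Local Notation X := (projective_model D I).
Local Notation star := (nagata_star D I).
Local Notation "p %:F" := (tofrac p).

Variable N : set K -> set K.

(* The stalks of a quasi-coherent sheaf of ideals: the last condition says that
   on Spec A the sections over D(f) extend after multiplication by powers of
   [f]. *)
Record quasi_coherent_family : Prop := {
  qcf_ideal : forall R, X R -> is_ideal R (N R);
  qcf_open : forall R x, X R -> N R x -> exists2 F : seq K, [set` F] `<=` R &
    forall R', X R' -> [set` F] `<=` R' -> N R' x;
  qcf_affine : forall R, X R -> exists A, [/\ subring A, local_rings A R,
    local_rings A `<=` X,
    exists2 F : seq K, [set` F] `<=` R &
      X `&` [set R' | [set` F] `<=` R'] `<=` local_rings A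
    & forall f s, A f -> f != 0 ->
        (forall R', local_rings A R' -> unit_in R' f -> N R' s) ->
        exists n, forall R', local_rings A R' -> N R' (f ^+ n * s)] }.

Hypothesis qcN : quasi_coherent_family.

Definition star_ideal_of : set {fraction {poly K}} :=
  \bigcap_(R in X) nagata_ext R (N R).

Lemma star_ideal_of_ideal : is_ideal star star_ideal_of.
Proof.
have idE R (XR : X R) := nagata_ext_ideal (model_local XR) (qcf_ideal qcN XR).
split.
- by move=> z Jz R XR; apply: (ideal_subset (idE _ XR)); exact: Jz.
- by move=> R XR; exact: ideal_zero (idE _ XR).
- move=> z w Jz Jw R XR.
  by apply: (ideal_add (idE _ XR)); [exact: Jz|exact: Jw].
- move=> a z sa Jz R XR.
  by apply: (ideal_mull (idE _ XR)); [exact: sa|exact: Jz].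
Qed.

(* A section over the locus where [c : O(n)] does not vanish extends globally
   after multiplication by a power of [c]; in D^*, [c] corresponds to
   [c / gens_poly ^+ n]. *)
Lemma star_ideal_of_extend R x : X R -> N R x ->
  exists n c m, [/\ twist D I n c, nonvanishing I n c%:P R
    & star_ideal_of ((c%:P%:F / (gens_poly gens ^+ n)%:F) ^+ m * constant x)].
Proof.
move=> XR Nx; have [F FR FN] := qcf_open qcN XR Nx.
have [a ga] := model_gen XR.
have [n [c [tc uc cF]]] := twist_denom bd XR ga FR.
have fg : twform D I n (gens_poly gens ^+ n).
  rewrite -[X in twform _ _ X]mul1n; apply: (twformX bd).
  exact: gens_poly_twform bd.
have ng : X `<=` nonvanishing I n (gens_poly gens ^+ n).
  move=> S XS; rewrite -[X in nonvanishing _ X]mul1n.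
  apply: (nonvanishingX bd n XS (gens_poly_twform bd)).
  exact: gens_poly_nonvanishing bd _ XS.
pose w := c%:P%:F / (gens_poly gens ^+ n)%:F.
pose T V := exists m, forall R', X R' -> V R' ->
  nagata_ext R' (N R') (w ^+ m * constant x).
have idE S (XS : X S) := nagata_ext_ideal (model_local XS) (qcf_ideal qcN XS).
have nagw S (XS : X S) m : nagata S (w ^+ m).
  apply: (subringX (nagata_subring (model_local XS))).
  exact: twform_frac XS (twformC tc) fg (ng _ XS).
suff [m Tm] : T X.
  exists n, c, m; split=> //; first exact: nonvanishingC ga uc.
  by move=> S XS; exact: Tm.
apply: (model_quasi_compact bd).
- by exists 0%N.
- by move=> V W VW [m Tm]; exists m => S XS /VW; exact: Tm.
- have raise S k m : X S -> nagata_ext S (N S) (w ^+ m * constant x) ->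
      nagata_ext S (N S) (w ^+ (k + m) * constant x).
    move=> XS Nm; rewrite exprD -mulrA.
    by apply: (ideal_mull (idE _ XS)) => //; exact: nagw.
  move=> V W [k Tk] [m Tm]; exists (k + m)%N => S XS [VS|WS].
    by rewrite addnC; apply: raise => //; exact: Tk.
  by apply: raise => //; exact: Tm.
- move=> S XS; have [b gb] := model_gen XS; have [Ib b0 Sb] := gb.
  have [A [rA AS AX [G GS GA] qcA]] := qcf_affine qcN XS.
  have rS := model_subring XS.
  pose f := c / b ^+ n.
  have Sf : S f by exact: tc.
  have [P primeP SE] := AS.
  (* [g] clears the denominators, with respect to [A], of [f] and of the quotients [y / b]; where
     [g] is a unit, [b] generates [I]. *)
  have [|g [Ag Pg gH]] :=
      localization_denom (F := f :: [seq y / b | y <- gens]) rA primeP.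
    move=> y; rewrite SE /= inE => /predU1P[-> //|/mapP[z gz ->]].
    by apply: Sb; exact: (bd_gens bd).
  have ug : unit_in S g by rewrite -SE; exact: localization_unit.
  have [_ g0 Sg'] := ug.
  have gen_b S' : local_rings A S' -> unit_in S' g -> local_gen I S' b.
    move=> AS' ug'; have XS' := AX _ AS'.
    apply: (local_gen_nbhd bd) => // y yH.
    apply: (unit_in_cancel (model_subring XS') ug').
    apply: (local_rings_sub rA AS'); apply: gH.
    by rewrite inE (yH : y \in _) orbT.
  have Agf : A (g * f) by apply: gH; rewrite inE eqxx.
  have c0 : c != 0 by case: uc => _ + _; apply: contra_neq => ->; rewrite mul0r.
  have gf0 : g * (g * f) != 0.
    by rewrite !mulf_neq0 // invr_eq0 expf_neq0.
  (* The product [g * f] lies in [A], while [f] itself may not. The extra factor [g] makes both [g]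
     and [f] units on the standard open set, so that [x] belongs to the stalks there. *)
  have [|m Nm] := qcA (g * (g * f)) x (subringM rA Ag Agf) gf0.
    move=> S' AS' ugf; have XS' := AX _ AS'; have rS' := model_subring XS'.
    have AsubS' := local_rings_sub rA AS'.
    have ug' := unit_in_factor rS' (AsubS' _ Ag) (AsubS' _ Agf) ugf.
    have gb' := gen_b _ AS' ug'.
    have uf : unit_in S' f.
      apply: (unit_in_factor rS' (tc _ _ XS' gb') (AsubS' _ Ag)); rewrite mulrC.
      by apply: (unit_in_factor rS' (AsubS' _ Agf) (AsubS' _ Ag)); rewrite mulrC.
    apply: FN => // y yF; apply: (unit_in_cancel rS' uf).
    by rewrite /f mulrAC; apply: (cF _ yF).
  exists (g^-1 :: G).
    by move=> y; rewrite /= inE => /predU1P[-> //|]; exact: GS.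
  exists m => S' XS' [_ GS'].
  have AS' : local_rings A S'.
    by apply: GA; split=> // y yG; apply: GS'; rewrite /= inE (yG : y \in G) orbT.
  have rS' := model_subring XS'.
  have ug' : unit_in S' g.
    split=> //; first exact: (local_rings_sub rA AS').
    by apply: GS'; rewrite /= inE eqxx.
  have gb' := gen_b _ AS' ug'.
  have idN := qcf_ideal qcN XS'.
  have Nfx : N S' (f ^+ m * x).
    have -> : f ^+ m * x = (g^-1 * g^-1) ^+ m * ((g * (g * f)) ^+ m * x).
      by rewrite [RHS]mulrA -exprMn; congr (_ ^+ m * _); field.
    apply: (ideal_mull idN); last exact: Nm.
    by apply: (subringX rS'); case: ug' => _ _ Sg; exact: (subringM rS').
  (* [w] is the constant [f] times the quotient of [b ^+ n] by [gens_poly gens ^+ n], which is in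
     S'(t). *)
  have -> : w ^+ m * constant x =
      ((b ^+ n)%:P%:F / (gens_poly gens ^+ n)%:F) ^+ m * constant (f ^+ m * x).
    rewrite /w /constant polyCM tofracM [RHS]mulrA; congr (_ * _).
    rewrite [(f ^+ m)%:P]polyC_exp [(_ ^+ m)%:F]tofracXn -[RHS]exprMn.
    congr (_ ^+ m).
    rewrite mulrAC; congr (_ / _).
    by rewrite -tofracM -polyCM /f mulrC divfK // expf_neq0.
  apply: (ideal_mull (idE _ XS')).
    apply: (subringX (nagata_subring (model_local XS'))).
    apply: (twform_frac XS' _ fg (ng _ XS')); apply: twformC.
    by rewrite -[X in twist _ _ X]mul1n; apply: (twistX bd); exact: twist_I.
  exact: nagata_ext_constant (model_local XS') idN _ Nfx.
Qed.

(** For [x] in the stalk, [star_ideal_of_extend] puts a multiple of [x] into the ideal; the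
    multiplier is a unit of R(t), because [c] does not vanish at [R]. *)
Lemma star_ideal_of_ext R : X R ->
  generated_ideal (nagata R) star_ideal_of = nagata_ext R (N R).
Proof.
move=> XR; have rRt := nagata_subring (model_local XR).
have idE := nagata_ext_ideal (model_local XR) (qcf_ideal qcN XR).
apply/seteqP; split.
  by apply: generated_ideal_sub => // z; apply.
have JRt : star_ideal_of `<=` nagata R.
  by move=> z /(_ R XR); exact: ideal_subset idE _.
have idg := generated_ideal_ideal rRt JRt.
rewrite (nagata_ext_generated (model_local XR) (qcf_ideal qcN XR)).
apply: generated_ideal_sub => // _ [x Nx <-].
have [n [c [m [tc nc Jx]]]] := star_ideal_of_extend XR Nx.
have fg : twform D I n (gens_poly gens ^+ n).
  rewrite -[X in twform _ _ X]mul1n; apply: (twformX bd).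
  exact: gens_poly_twform bd.
set u := c%:P%:F in Jx; set v := (_ ^+ n)%:F in Jx.
have u0 : u != 0 by rewrite tofrac_eq0; exact: nonvanishing_neq0 nc.
have v0 : v != 0.
  have : nonvanishing I n (gens_poly gens ^+ n) R.
    rewrite -[X in nonvanishing _ X]mul1n.
    apply: (nonvanishingX bd n XR (gens_poly_twform bd)).
    exact: gens_poly_nonvanishing bd _ XR.
  by rewrite tofrac_eq0; exact: nonvanishing_neq0.
have -> : constant x = (v / u) ^+ m * ((u / v) ^+ m * constant x).
  have vu1 := divf_mul_divf 1 u0 v0; rewrite mulr1 in vu1.
  by rewrite mulrA -exprMn -vu1 expr1n mul1r.
apply: (ideal_mull idg); last exact: sub_generated_ideal.
apply: (subringX rRt); exact: twform_frac XR fg (twformC tc) nc.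
Qed.

Lemma star_ideal_of_contraction R : X R -> contraction star_ideal_of R = N R.
Proof.
move=> XR; have idN := qcf_ideal qcN XR; have locR := model_local XR.
apply/seteqP; split=> x.
  by rewrite /contraction star_ideal_of_ext // => -[_ /(nagata_ext_contract idN)].
move=> Nx; split; first exact: ideal_subset idN _ Nx.
by rewrite star_ideal_of_ext //; exact: nagata_ext_constant.
Qed.

Lemma star_ideal_of_relevant : relevant_ideal D I star_ideal_of.
Proof.
split; first exact: star_ideal_of_ideal.
move=> R XR; have locR := model_local XR; have idN := qcf_ideal qcN XR.
rewrite star_ideal_of_ext //; split; first exact: nagata_ext_ideal.
rewrite {1}nagata_ext_generated //.
congr (generated_ideal _ _); apply/seteqP; split=> z.
  move=> [x Nx <-]; split; first exact: nagata_ext_constant.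
  by exists x => //; exact: ideal_subset idN _ Nx.
by move=> [+ [x Rx xz]]; rewrite -xz => /(nagata_ext_contract idN) Nx; exists x.
Qed.

End StalkFamily.

(** * Sheaves of ideals and their stalks *)

Section SubringType.
Variables (K : fieldType) (A : set K).

(** The closure proof is an argument so that the closure instances can be attached to the predicate;
    likewise for modules below. *)
Definition subring_pred of subring A : {pred K} := mem A.

Variable rA : subring A.

HB.instance Definition _ := GRing.isSubringClosed.Build K (subring_pred rA) rA.

Definition subring_type := {x : K | x \in subring_pred rA}.

HB.instance Definition _ := [isSub of subring_type for sval].
HB.instance Definition _ := [Choice of subring_type by <:].
HB.instance Definition _ := [SubChoice_isSubComNzRing of subring_type by <:].

Variable n : set K.
Definition is_subset_module := [/\ n 0, forall x y, n x -> n y -> n (x - y)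
  & forall a x, A a -> n x -> n (a * x)].

Definition subset_module_pred of is_subset_module : {pred K} := mem n.

Variable mn : is_subset_module.

Fact subset_module_zmod_closed : zmod_closed (subset_module_pred mn).
Proof.
have [n0 nB _] := mn; split; first exact: mem_set.
by move=> x y /set_mem nx /set_mem ny; exact/mem_set/nB.
Qed.

HB.instance Definition _ :=
  GRing.isZmodClosed.Build K (subset_module_pred mn) subset_module_zmod_closed.

Definition subset_module := {x : K | x \in subset_module_pred mn}.

HB.instance Definition _ := [isSub of subset_module for sval].
HB.instance Definition _ := [Choice of subset_module by <:].
HB.instance Definition _ := [SubChoice_isSubZmodule of subset_module by <:].

Fact subset_module_scale_subproof (a : subring_type) (x : subset_module) :
  val a * val x \in subset_module_pred mn.
Proof. by have [_ _ nM] := mn; apply/mem_set/nM; apply: set_mem (valP _). Qed.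

Definition subset_module_scale a x : subset_module :=
  exist _ (val a * val x) (subset_module_scale_subproof a x).

Fact subset_module_scaleA a b x :
  subset_module_scale a (subset_module_scale b x) = subset_module_scale (a * b) x.
Proof. by apply: val_inj; rewrite /= mulrA. Qed.

Fact subset_module_scale1 : left_id 1 subset_module_scale.
Proof. by move=> x; apply: val_inj; rewrite /= mul1r. Qed.

Fact subset_module_scaleDr : right_distributive subset_module_scale +%R.
Proof. by move=> a x y; apply: val_inj; rewrite /= mulrDr. Qed.

Fact subset_module_scaleDl x : {morph subset_module_scale^~ x : a b / a + b}.
Proof. by move=> a b; apply: val_inj; rewrite /= mulrDl. Qed.

HB.instance Definition _ := GRing.Zmodule_isLmodule.Build subring_type subset_module
  subset_module_scaleA subset_module_scale1 subset_module_scaleDr subset_module_scaleDl.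

Definition subring_val : {rmorphism subring_type -> K} := val.

Definition subset_module_val (x : subset_module) : K := val x.

Fact subset_module_val_linear :
  linear_for (subring_val \; *%R) subset_module_val.
Proof. by []. Qed.

HB.instance Definition _ := GRing.isLinear.Build subring_type subset_module K
  (subring_val \; *%R) subset_module_val subset_module_val_linear.

Lemma subring_val_range : range subring_val = A.
Proof.
apply/seteqP; split=> [x [[y Ay] _ <-]|x Ax]; first exact: set_mem Ay.
by exists (exist _ x (mem_set Ax)).
Qed.

End SubringType.

(** * Passage between sheaves of ideals and families of stalks *)

Section Sheaves.
Variables (K : fieldType) (D I : set K) (gens : seq K).
Hypothesis bd : blowup_data D I gens.

Local Notation X := (projective_model D I).
Local Notation M := (model D I).
Implicit Types (U V : set M) (N : set K -> set K) (F : set M -> set K).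

Lemma model_openP U : open U <-> forall R, U R ->
  exists2 F : seq K, [set` F] `<=` sval R &
    forall R' : M, [set` F] `<=` sval R' -> U R'.
Proof.
split.
  move=> [E sE <-] R [F EF FR].
  have /finite_seqP[s sF] := sE _ EF.
  exists s; first by rewrite -sF.
  by move=> R' sR'; exists F => //; rewrite /zariski_basic/= sF.
move=> UF; exists [set E | finite_set E /\ zariski_basic E `<=` U].
  by move=> E [].
apply/seteqP; split.
  by move=> R [E [_ EU] /EU].
move=> R /UF[F FR FU]; exists [set` F]; last exact: FR.
by split; [exact: finite_seq|move=> R' /FU].
Qed.

Lemma model_inj (R R' : M) : sval R = sval R' -> R = R'.
Proof. by case: R R' => [R XR] [R' XR'] /=; exact: eq_exist. Qed.

Lemma open_seq (F : seq K) : open [set R : M | [set` F] `<=` sval R].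
Proof. by apply/model_openP => R FR; exists F. Qed.

Definition generic_point : M := exist _ setT (model_generic bd).

Lemma open_generic U R : open U -> U R -> U generic_point.
Proof. by move=> /model_openP oU /oU[F _]; apply; exact: subsetT. Qed.

Lemma restr_point U R (x : K) : U R -> restr U x = x.
Proof. by move=> UR; rewrite /restr; case: eqP => // U0; rewrite U0 in UR. Qed.

Lemma structure_sheaf_point U R x : U R ->
  structure_sheaf U x <-> forall R', U R' -> sval R' x.
Proof.
move=> UR; rewrite /structure_sheaf; case: eqP => [U0|_]; last by split.
by rewrite U0 in UR.
Qed.

(** The first two clauses follow the encoding of sheaves: no sections on sets that are not open, and
    only 0 on [set0]. *)
Definition sheaf_of_stalks N U : set K := [set x |
  [/\ open U, U = set0 -> x = 0 & forall R, U R -> N (sval R) x]].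

Lemma sheaf_of_stalks_point N U R x : U R ->
  sheaf_of_stalks N U x <-> open U /\ forall R', U R' -> N (sval R') x.
Proof.
move=> UR; split=> [[]//|[oU Nx]]; split=> // U0.
by rewrite U0 in UR.
Qed.

Lemma sheaf_of_stalks_sheaf N : (forall R, X R -> is_ideal R (N R)) ->
  sheaf_of_ideals (sheaf_of_stalks N).
Proof.
move=> idN; have idM (R : M) : is_ideal (sval R) (N (sval R)).
  by apply: idN; exact: svalP R.
split.
- by move=> U nU; apply/seteqP; split=> // x [].
- move=> U oU; split.
  + move=> x [_ Ux Nx]; rewrite /structure_sheaf; case: eqP => [/Ux //|_] R UR.
    by apply: (ideal_subset (idM R)); exact: Nx.
  + by split=> // R _; exact: ideal_zero (idM R).
  + move=> x y [_ Ux Nx] [_ Uy Ny]; split=> // [U0|R UR].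
      by rewrite Ux // Uy // addr0.
    by apply: (ideal_add (idM R)); [exact: Nx|exact: Ny].
  + move=> a x Oa [_ Ux Nx]; split=> // [U0|R UR].
      by rewrite Ux // mulr0.
    apply: (ideal_mull (idM R)); last exact: Nx.
    exact: (structure_sheaf_point a UR).1.
- move=> U V oU oV VU s [_ Us Ns]; rewrite /restr; case: eqP => [->|/eqP V0].
    by split; [exact: open0|by []|].
  by split=> // [V0'|R /VU]; [move: V0; rewrite V0' eqxx|exact: Ns].
- move=> T U s oU Fs scompat.
  have oUU : open (\bigcup_i U i) by apply: bigcup_open => i _; exact: oU.
  (* If the whole cover is empty, the glued section is 0; otherwise a nonempty member provides
     it. *)
  have [[i0 [R0 UR0]]|noU] := pselect (exists i R, U i R); last first.
    have U0 i : U i = set0.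
      by apply/seteqP; split=> // R UR; apply: noU; exists i, R.
    have UU0 : \bigcup_i U i = set0 by apply: bigcup0 => i _; exact: U0.
    exists 0; split.
      split; first by split=> // R; rewrite UU0.
      move=> i; have [_ -> //] := Fs i.
      by rewrite /restr U0 eqxx.
    by move=> r [[_ -> //]].
  (* Nonempty open sets meet in the generic point, so that compatible sections over them are equal
     in [K]. *)
  have restr_s i R : U i R -> s i = s i0.
    move=> UR; have := scompat i i0.
    have Ug : (U i `&` U i0) generic_point.
      by split; [exact: open_generic UR|exact: open_generic UR0].
    by rewrite !(restr_point _ Ug).
  exists (s i0); split.
    split; first (split=> //).
    + have UUR0 : (\bigcup_i U i) R0 by exists i0.
      by move=> U0; rewrite U0 in UUR0.
    + by move=> R [i _ UR]; rewrite -(restr_s _ _ UR); have [_ _] := Fs i; apply.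
    + move=> i; have [U0|/set0P[R UR]] := eqVneq (U i) set0.
        by have [_ ->] := Fs i; rewrite // /restr U0 eqxx.
      by rewrite (restr_point _ UR) (restr_s _ _ UR).
  by move=> r [_ /(_ i0)]; rewrite (restr_point _ UR0).
Qed.

Section Stalks.
Variable F : set M -> set K.
Hypothesis shF : sheaf_of_ideals F.

(** Restriction maps between nonempty open sets are inclusions in [K], so the direct limit of the
    sections is their union. *)
Definition stalk (R : set K) : set K :=
  [set x | exists U, [/\ open U, exists2 R', U R' & sval R' = R & F U x]].

Let F_open U x : F U x -> open U.
Proof.
case: shF => F0 _ _ _ Fx; apply: contrapT => nU.
by move: Fx; rewrite F0.
Qed.

Let F_ideal U : open U -> is_ideal (structure_sheaf U) (F U).
Proof. by case: shF => _ + _ _; apply. Qed.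

Lemma sheaf_restr U V R x : open V -> V `<=` U -> V R -> F U x -> F V x.
Proof.
move=> oV VU VR Fx; have [_ _ Fr _] := shF.
by have := Fr _ _ (F_open Fx) oV VU _ Fx; rewrite (restr_point _ VR).
Qed.

Lemma stalk_point (R : M) x :
  stalk (sval R) x <-> exists U, [/\ open U, U R & F U x].
Proof.
split=> [[U [oU [R' UR' RR'] Fx]]|[U [oU UR Fx]]]; last first.
  by exists U; split=> //; exists R.
by exists U; split=> //; rewrite -(model_inj RR').
Qed.

(** An [x] in all the stalks over [U] is glued from copies of itself on the nonempty open sets where
    it is a section; restriction to these changes no element, so the result is [x]. *)
Lemma sheaf_stalks : F = sheaf_of_stalks stalk.
Proof.
apply/funext => U; apply/seteqP; split=> x.
  move=> Fx; have oU := F_open Fx; split=> //.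
    move=> U0; have := ideal_subset (F_ideal oU) Fx.
    by rewrite /structure_sheaf U0 eqxx.
  by move=> R UR; apply/stalk_point; exists U.
move=> [oU Ux Sx].
have [U0|/set0P[R0 UR0]] := eqVneq U set0.
  by rewrite Ux //; exact: ideal_zero (F_ideal oU).
pose Q V := [/\ open V, V `<=` U, V !=set0 & F V x].
pose T := {V : set M | Q V}.
pose W (V : T) : set M := sval V.
have WU : \bigcup_V W V = U.
  apply/seteqP; split=> [R [[V PV] _ VR]|R UR].
    by have [_ VU _ _] := PV; exact: VU.
  have /stalk_point[V [oV VR Fx]] := Sx _ UR.
  have VUR : (V `&` U) R by [].
  have oVU : open (V `&` U) by exact: openI.
  suff PV : Q (V `&` U) by exists (exist Q _ PV).
  split; [exact: oVU|exact: subIsetr|by exists R|].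
  by apply: (sheaf_restr oVU _ VUR Fx); exact: subIsetl.
have [_ _ _ glue] := shF.
have [|||r [[]]] := glue T W (fun=> x).
- by move=> [V []].
- by move=> [V []].
- by [].
rewrite WU => Fr rx _.
have : (\bigcup_V W V) R0 by rewrite WU.
by move=> [V _ VR]; have := rx V; rewrite (restr_point _ VR) => <-.
Qed.

Lemma stalk_ideal R : X R -> is_ideal R (stalk R).
Proof.
move=> XR; rewrite -[R]/(sval (exist X R XR)); move: (exist _ _ _) => {XR}R.
have oI U V : open U -> U R -> open V -> V R -> open (U `&` V) /\ (U `&` V) R.
  by move=> oU UR oV VR; split; [exact: openI|].
split.
- move=> x /stalk_point[U [oU UR Fx]].
  by apply: (structure_sheaf_point x UR).1 => //; exact: ideal_subset (F_ideal oU) _ Fx.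
- apply/stalk_point; exists setT; split=> //; first exact: openT.
  by apply: ideal_zero (F_ideal _); exact: openT.
- move=> x y /stalk_point[U [oU UR Fx]] /stalk_point[V [oV VR Fy]].
  have [oUV UVR] := oI _ _ oU UR oV VR.
  apply/stalk_point; exists (U `&` V); split=> //.
  apply: (ideal_add (F_ideal oUV)).
    exact: (sheaf_restr oUV (@subIsetl _ U V) UVR Fx).
  exact: (sheaf_restr oUV (@subIsetr _ U V) UVR Fy).
- move=> a x Ra /stalk_point[U [oU UR Fx]].
  pose V := [set R' : M | [set` [:: a]] `<=` sval R'].
  have VR : V R by move=> y; rewrite /= inE => /eqP ->.
  have [oUV UVR] := oI _ _ oU UR (open_seq [:: a]) VR.
  apply/stalk_point; exists (U `&` V); split=> //.
  apply: (ideal_mull (F_ideal oUV)).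
    by apply/(structure_sheaf_point a UVR) => R' [_]; apply; rewrite /= inE.
  exact: (sheaf_restr oUV (@subIsetl _ U V) UVR Fx).
Qed.

Lemma stalk_open R x : X R -> stalk R x -> exists2 E : seq K, [set` E] `<=` R &
  forall R', X R' -> [set` E] `<=` R' -> stalk R' x.
Proof.
move=> XR; rewrite -[R]/(sval (exist X R XR)); move: (exist _ _ _) => {XR}R.
move=> /stalk_point[U [oU UR Fx]].
have [E ER EU] := (model_openP U).1 oU R UR.
exists E => // R' XR' ER'.
by apply/(stalk_point (exist _ _ XR')); exists U; split=> //; exact: EU.
Qed.

Lemma open_standard U f : open U -> open (standard_open U f).
Proof.
move=> /model_openP oU; apply/model_openP => R [/oU[E ER EU] [g Rg fg]].
exists (g :: E).
  by move=> y; rewrite /= inE => /predU1P[-> //|]; exact: ER.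
move=> R' gE; split; last by exists g => //; apply: gE; rewrite /= inE eqxx.
by apply: EU => y yE; apply: gE; rewrite /= inE (yE : y \in E) orbT.
Qed.

Lemma standard_unit U f R : standard_open U f R -> sval R f -> unit_in (sval R) f.
Proof.
move=> [_ [g Rg fg]] Rf.
have f0 : f != 0.
  apply/eqP => f0; move: fg; rewrite f0 mul0r => /esym/eqP.
  by rewrite oner_eq0.
by split=> //; have -> : f^-1 = g by rewrite -[LHS]mulr1 -fg mulKf.
Qed.

Lemma unit_standard U f R : U R -> unit_in (sval R) f -> standard_open U f R.
Proof. by move=> UR [_ f0 Rf]; split=> //; exists f^-1; rewrite ?mulfV. Qed.

Lemma standard_generic U f R : open U -> U R -> f != 0 ->
  standard_open U f generic_point.
Proof. by move=> oU UR f0; apply: unit_standard; [exact: open_generic UR|]. Qed.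

(** The affine condition comes from the surjectivity of [M_f] onto the sections over D(f): a power
    of [f] times such a section is some [theta m], a section over the whole affine set. *)
Lemma stalk_quasi_coherent : quasi_coherent F -> quasi_coherent_family D I stalk.
Proof.
move=> qcF; split; [exact: stalk_ideal|exact: stalk_open|].
move=> R XR; rewrite -[R]/(sval (exist X R XR)); move: (exist _ _ _) => {XR}R.
have [U [UR [A [iota [[oU iota_inj UA] [L [theta [Ftheta thetaP]]]]]]]] := qcF R.
have AU S : local_rings (range iota) S -> exists2 S' : M, U S' & sval S' = S.
  by rewrite -UA => -[S' US' <-]; exists S'.
exists (range iota); split.
- apply/subringP; split; first by exists 1; rewrite ?rmorph1.
    by move=> _ _ [x _ <-] [y _ <-]; exists (x - y); rewrite ?rmorphB.
  by move=> _ _ [x _ <-] [y _ <-]; exists (x * y); rewrite ?rmorphM.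
- by rewrite -UA; exists R.
- by move=> S /AU[S' _ <-]; exact: svalP S'.
- have [E ER EU] := (model_openP U).1 oU R UR; exists E => // S [XS ES].
  by rewrite -UA; exists (exist _ _ XS) => //; exact: EU.
- move=> _ s [f _ <-] f0 Ns.
  have [thetaf _] := thetaP f.
  set Uf := standard_open U (iota f) in thetaf.
  have Ufg : Uf generic_point by exact: standard_generic UR f0.
  have oUf : open Uf by exact: open_standard.
  have rA : subring (range iota).
    apply/subringP; split; first by exists 1; rewrite ?rmorph1.
      by move=> _ _ [x _ <-] [y _ <-]; exists (x - y); rewrite ?rmorphB.
    by move=> _ _ [x _ <-] [y _ <-]; exists (x * y); rewrite ?rmorphM.
  have [|n [m]] := thetaf s.
    rewrite sheaf_stalks; apply/(sheaf_of_stalks_point _ _ Ufg).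
    split=> // S UfS; have [US _] := UfS; apply: Ns; first by rewrite -UA; exists S.
    apply: (standard_unit UfS); apply: (local_rings_sub rA (A := range iota)).
      by rewrite -UA; exists S.
    by exists f.
  rewrite !(restr_point _ Ufg) => e; exists n => S /AU[S' US' <-].
  by rewrite e; apply/stalk_point; exists U; split.
Qed.

End Stalks.

(** The affine set is the locus where [a] generates [I], the module consists of the sections over
    it, and [theta] is the inclusion; the second hypothesis extends sections from D(f). *)
Lemma chart_quasi_coherent N : (forall R, X R -> is_ideal R (N R)) ->
  (forall a f s, I a -> a != 0 -> chart_ring D I a f ->
     (forall R, local_rings (chart_ring D I a) R -> unit_in R f -> N R s) ->
     exists n, forall R, local_rings (chart_ring D I a) R -> N R (f ^+ n * s)) ->
  quasi_coherent (sheaf_of_stalks N).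
Proof.
move=> idN qcN R; have [a ga] := model_gen (svalP R); have [Ia a0 _] := ga.
pose A := chart_ring D I a.
have rA : subring A := chart_subring D I a.
pose U : set M := [set R' | local_gen I (sval R') a].
have UA : [set sval R' | R' in U] = local_rings A.
  apply/seteqP; split=> [_ [S US <-]|S AS].
    exact: local_gen_rings (svalP S) US.
  have XS := chart_model Ia a0 AS.
  by exists (exist _ _ XS) => //; exact: local_rings_gen Ia a0 AS.
have UAS (S : M) : U S -> local_rings A (sval S) by rewrite -UA; exists S.
have oU : open U.
  apply/model_openP => S [_ _ Sa]; exists [seq y / a | y <- gens].
    by move=> _ /mapP[y gy ->]; apply: Sa; exact: (bd_gens bd).
  by move=> S' gS'; apply: (local_gen_nbhd bd) => //; exact: svalP S'.
have UR : U R by [].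
exists U; split=> //.
exists (subring_type rA), (subring_val rA); split.
  split=> //.
  by rewrite subring_val_range.
have idM (S : M) : is_ideal (sval S) (N (sval S)).
  by apply: idN; exact: svalP S.
have FU x := sheaf_of_stalks_point N x UR.
have mn : is_subset_module A (sheaf_of_stalks N U).
  split.
  - by apply/FU; split=> // S _; exact: ideal_zero (idM S).
  - move=> x y /FU[_ Nx] /FU[_ Ny]; apply/FU; split=> // S US.
    rewrite -mulN1r; apply: (ideal_add (idM S)); first exact: Nx.
    apply: (ideal_mull (idM S)); last exact: Ny.
    have rS := model_subring (svalP S).
    by apply: (subringN rS); exact: subring1.
  - move=> b x Ab /FU[_ Nx]; apply/FU; split=> // S US.
    apply: (ideal_mull (idM S)); last exact: Nx.
    exact: (local_rings_sub rA (UAS _ US)).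
exists (subset_module mn), (subset_module_val (mn := mn)); split.
  by move=> m; exact: set_mem (valP m).
move=> f Uf; have Af : A (subring_val rA f) by exact: set_mem (valP f).
(* D(0) is empty, so that everything restricts to 0 there, and the first power of 0 annihilates the
   module. *)
have [f0|f0] := eqVneq (subring_val rA f) 0.
  have Uf0 : Uf = set0.
    apply/seteqP; split=> // S [_ [g _]]; rewrite f0 mul0r => /esym/eqP.
    by rewrite oner_eq0.
  split=> [s [_ s0 _]|m _].
    exists 0%N, 0; rewrite s0 // /restr Uf0 eqxx mulr0 //.
  exists 1%N; apply: val_inj => /=.
  by rewrite (_ : val f = 0) ?mul0r.
have Ufg : Uf generic_point by exact: standard_generic UR f0.
have oUf : open Uf by exact: open_standard.
split=> [s /(sheaf_of_stalks_point _ _ Ufg)[_ Ns]|m].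
  have [|n Nfs] := qcN a _ s Ia a0 Af.
    move=> S AS uf; have := AS; rewrite -/A -UA => -[S' US' S'S].
    by move: uf; rewrite -S'S => uf; apply: Ns; exact: unit_standard.
  have nx : sheaf_of_stalks N U (subring_val rA f ^+ n * s).
    by apply/FU; split=> // S US; apply: Nfs; exact: UAS.
  exists n, (exist (fun x => x \in subset_module_pred mn) _ (mem_set nx)).
  by rewrite !(restr_point _ Ufg).
rewrite (restr_point _ Ufg) => m0; exists 0%N; rewrite expr0 scale1r.
exact: val_inj.
Qed.

End Sheaves.

(** * The correspondence *)

Section Bijection.
Variables (K : fieldType) (D I : set K) (gens : seq K).
Hypothesis bd : blowup_data D I gens.

Local Notation X := (projective_model D I).

Definition sheaf_of_star_ideal J : set (model D I) -> set K :=
  sheaf_of_stalks (contraction J).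

Lemma sheaf_of_relevant_ideal J : relevant_ideal D I J ->
  quasi_coherent_ideal_sheaf (sheaf_of_star_ideal J).
Proof.
move=> relJ; have idN R (XR : X R) := contraction_ideal relJ XR.
split; first exact: (sheaf_of_stalks_sheaf bd idN).
apply: (chart_quasi_coherent bd idN) => a f s Ia a0 Af Ns.
exact: (contraction_quasi_coherent bd relJ Ia a0 Af Ns).
Qed.

(** By [contraction_open], an element of the contraction at [R] is a section in a neighbourhood of
    [R]. *)
Lemma stalk_sheaf_of_star_ideal J R : relevant_ideal D I J -> X R ->
  stalk (sheaf_of_star_ideal J) R = contraction J R.
Proof.
move=> relJ XR; pose R' : model D I := exist _ R XR.
apply/seteqP; split=> x.
  by move=> /(stalk_point _ R')[U [oU UR [_ _ Nx]]]; exact: Nx UR.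
move=> Nx; have [F FR FN] := contraction_open bd relJ XR Nx.
apply/(stalk_point _ R'); exists [set S : model D I | [set` F] `<=` sval S].
have oU : open [set S : model D I | [set` F] `<=` sval S] by exact: open_seq.
split=> //; apply/(@sheaf_of_stalks_point _ _ _ _ _ R') => //.
by split=> // S FS; apply: FN => //; exact: svalP S.
Qed.

(** The right side is the intersection of the extensions of [J] to the rings R(t), which is [J] by
    [star_ideal_local]. *)
Lemma relevant_ideal_stalks J : relevant_ideal D I J ->
  J = star_ideal_of D I (stalk (sheaf_of_star_ideal J)).
Proof.
move=> relJ; have [idJ _] := relJ.
apply/seteqP; split=> z.
  move=> Jz R XR; rewrite stalk_sheaf_of_star_ideal // -(relevant_ext relJ XR).
  exact: sub_generated_ideal.
move=> Jz.
have Jz' R : X R -> generated_ideal (nagata R) J z.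
  move=> XR; rewrite (relevant_ext relJ XR) -stalk_sheaf_of_star_ideal //.
  exact: Jz.
apply: (star_ideal_local bd idJ) => // R XR.
exact: (ideal_subset (generated_relevant_ideal relJ XR) (Jz' _ XR)).
Qed.

(** The inverse is [star_ideal_of] applied to the stalks: [relevant_ideal_stalks] gives one
    composite, [star_ideal_of_contraction] and [sheaf_stalks] the other. *)
Lemma sheaf_of_star_ideal_bij :
  set_bij [set J | relevant_ideal D I J]
          [set F | quasi_coherent_ideal_sheaf F] sheaf_of_star_ideal.
Proof.
split.
- by move=> J; exact: sheaf_of_relevant_ideal.
- move=> J J' /set_mem relJ /set_mem relJ' e.
  by rewrite (relevant_ideal_stalks relJ) e -relevant_ideal_stalks.
- move=> F [shF qcF]; have qcN := stalk_quasi_coherent bd shF qcF.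
  exists (star_ideal_of D I (stalk F)); first exact: (star_ideal_of_relevant bd qcN).
  rewrite [RHS](sheaf_stalks shF); apply/funext => U; apply/seteqP.
  have e (R : model D I) :
      contraction (star_ideal_of D I (stalk F)) (sval R) = stalk F (sval R).
    by apply: (star_ideal_of_contraction bd qcN); exact: svalP R.
  split=> x [oU Ux Nx]; split=> // R UR; first by rewrite -e; exact: Nx.
  by rewrite e; exact: Nx.
Qed.

End Bijection.

(** * Transfer from a domain to its fraction field *)

Lemma fraction_numden (R : idomainType) (z : {fraction R}) :
  exists n d : R, d != 0 /\ z = tofrac n / tofrac d.
Proof.
elim/quotW: z => x; have d0 := denom_ratioP x.
exists (frac x).1, (frac x).2; split=> //.
apply: (canRL (mulfK _)); first by rewrite tofrac_eq0.
unlock FracField.tofrac; rewrite -[LHS]FracField.pi_mul; apply/eqmodP.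
rewrite /= FracField.equivfE /FracField.mulf.
by rewrite !numden_Ratio ?(mulr1, oner_neq0) // mulrC.
Qed.

Lemma fraction_blowup_data (D : idomainType) (I : set D) (s : seq D) :
  I = generated_ideal [set: D] [set` s] -> (exists2 x, I x & x != 0) ->
  blowup_data (range (@tofrac D)) ((@tofrac D) @` I) (map (@tofrac D) s).
Proof.
move=> IE [x0 Ix0 x00].
have sI : [set` s] `<=` I by rewrite IE; exact: sub_generated_ideal.
split.
- apply/subringP; split; first by exists 1; rewrite ?tofrac1.
    by move=> _ _ [x _ <-] [y _ <-]; exists (x - y); rewrite ?tofracB.
  by move=> _ _ [x _ <-] [y _ <-]; exists (x * y); rewrite ?tofracM.
- move=> z; have [x [y [y0 ->]]] := fraction_numden z.
  by exists (tofrac x), (tofrac y); rewrite tofrac_eq0; split.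
- by move=> _ /mapP[x xs ->]; exists x => //; exact: sI.
- move=> S S0 SD SM Ss _ [x Ix <-].
  (* The preimage of [S] is an ideal of [D] containing the generators, hence contains [I]. *)
  pose S' := [set y | S (tofrac y)].
  suff : S' x by [].
  move: Ix; rewrite IE; apply: generated_ideal_sub.
    split.
    + by [].
    + exact: S0.
    + by move=> y z Sy Sz; rewrite /S'/= tofracD; exact: SD.
    + by move=> a y _ Sy; rewrite /S'/= tofracM; apply: SM => //; exists a.
  by move=> y ys; apply: Ss; apply: map_f.
- by exists (tofrac x0); [exists x0|rewrite tofrac_eq0].
Qed.

Theorem corollary4p7 (D : idomainType) (I : set D)
    (I_fg : finitely_generated_ideal [set: D] I)
    (I_neq0 : exists2 x, I x & x != 0) :
  let K := {fraction D} in
  let DK : set K := range (@tofrac D) in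
  let IK : set K := (@tofrac D) @` I in
  exists Phi : set {fraction {poly K}} -> (set (model DK IK) -> set K),
    set_bij [set J | relevant_ideal DK IK J]
            [set F | quasi_coherent_ideal_sheaf F] Phi.
Proof.
have [_ [G /finite_seqP[s Gs] IG]] := I_fg.
rewrite Gs in IG; exists (@sheaf_of_star_ideal _ _ _).
exact: sheaf_of_star_ideal_bij (fraction_blowup_data IG I_neq0).
Qed.
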